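(* Assume $m,n$ are positive integers with $$1<\tfrac mn,\qquad (m,n)\notin\{(3,2),(5,2),(7,2),\ldots\}.$$ Let $\|\cdot\|_1$ be an arbitrary norm on $\mathbb{R}^n$ and $\|\cdot\|_2$ any expanding norm on $\mathbb{R}^m$; if $n=2$, assume in addition that $\|\cdot\|_1$ is expanding as well. Then there exists $c_{m,n}=c_{m,n}(\|\cdot\|_1,\|\cdot\|_2)>0$ so that for any $c\in[0,c_{m,n}]$ we have $$FS_{m,n}(\|\cdot\|_1,\|\cdot\|_2,c)\ne\emptyset.$$ In fact, unless $n=2$ or $(m,n)=(4,3)$, for all such $c$ we have $$\dim_H FS_{m,n}(\|\cdot\|_1,\|\cdot\|_2,c)\ \ge\ m(n-1)-\left\lceil\frac mn\right\rceil,$$ and for $(m,n)=(4,3)$ we still have the weaker bound $\dim_H FS_{4,3}(\|\cdot\|_1,\|\cdot\|_2,c)\ge4$. In particular, the Dirichlet spectrum $\mathcal{D}_{m,n}(\|\cdot\|_1,\|\cdot\|_2)$ contains a right neighborhood of $0$. Moreover, all these claims remain true when one restricts to matrices of full $\mathbb{R}$-rank $n$.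
   Context: A norm $\|\cdot\|$ on $\mathbb{R}^k$ is called expanding if $\|\boldsymbol{x}\|\ge\|\pi_j(\boldsymbol{x})\|$ for all $\boldsymbol{x}\in\mathbb{R}^k$ and $1\le j\le k$, where $\pi_j(x_1,\dots,x_k)=(0,\dots,0,x_j,0,\dots,0)$. $\lceil x\rceil$ is the smallest integer $\ge x$. For norms $\|\cdot\|_1$ on $\mathbb{R}^n$ and $\|\cdot\|_2$ on $\mathbb{R}^m$, $\Omega\in\mathbb{R}^{m\times n}$ and $t\ge1$ let $$\psi_\Omega(t)=\min\{\|\Omega\hat{\boldsymbol b}+\tilde{\boldsymbol b}\|_2:\hat{\boldsymbol b}\in\mathbb{Z}^n,\ \tilde{\boldsymbol b}\in\mathbb{Z}^m,\ 1\le\|\hat{\boldsymbol b}\|_1\le t\},$$ $\Theta(\Omega)=\limsup_{t\to\infty}t^{n/m}\psi_\Omega(t)$ and $\widetilde\Theta(\Omega)=\liminf_{t\to\infty}t^{n/m}\psi_\Omega(t)$. Put $DI_{m,n}(\|\cdot\|_1,\|\cdot\|_2,c)=\{\Omega\in\mathbb{R}^{m\times n}:\Theta(\Omega)=c\}$, $Bad_{m,n}=\{\Omega:\widetilde\Theta(\Omega)>0\}$ (independent of the norms), and for $c\ge0$ $$FS_{m,n}(\|\cdot\|_1,\|\cdot\|_2,c)=DI_{m,n}(\|\cdot\|_1,\|\cdot\|_2,c)\setminus Bad_{m,n}.$$ The Dirichlet spectrum is $\mathcal{D}_{m,n}(\|\cdot\|_1,\|\cdot\|_2)=\{\Theta(\Omega):\Omega\in\mathbb{R}^{m\times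 n}\}$. $\dim_H$ denotes Hausdorff dimension. *)

(* Defs.v *)
From HB Require Import structures.
From mathcomp Require Import all_boot all_order all_algebra.
From mathcomp Require Import all_classical all_reals all_analysis.

Set Implicit Arguments.
Unset Strict Implicit.
Unset Printing Implicit Defensive.

Import Order.TTheory GRing.Theory Num.Theory.
Import numFieldNormedType.Exports.

Local Open Scope classical_set_scope.
Local Open Scope ring_scope.

(* Nonnegativity follows: 0 = N (x - x) <= 2 * N x. *)
Definition is_norm (R : realType) (k : nat) (N : 'cV[R]_k -> R) : Prop :=
  [/\ forall x y, N (x + y) <= N x + N y,
      forall (a : R) x, N (a *: x) = `|a| * N x
    & forall x, N x = 0 -> x = 0].

Definition coord_proj (R : realType) (k : nat) (j : 'I_k) (x : 'cV[R]_k) :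
  'cV[R]_k := \col_i (if i == j then x i ord0 else 0).

Definition expanding (R : realType) (k : nat) (N : 'cV[R]_k -> R) : Prop :=
  forall (x : 'cV[R]_k) (j : 'I_k), N (coord_proj j x) <= N x.

Definition int_cV (R : realType) (k : nat) (b : 'cV[int]_k) : 'cV[R]_k :=
  map_mx intr b.
Arguments int_cV R {k} b.

Section DirichletConstants.
Variables (R : realType) (m n : nat).
Variables (N1 : 'cV[R]_n -> R) (N2 : 'cV[R]_m -> R).
Implicit Types (Om : 'M[R]_(m, n)) (t c : R).

(* For norms N1 and N2 the infimum is a minimum as soon as some integer vector
   bh satisfies 1 <= N1 bh <= t, which holds for all large t; the value is +oo
   for the remaining t, which do not affect the limits t --> +oo below. *)
Definition psi Om t : \bar R :=
  ereal_inf [set (N2 (Om *m int_cV R b.1 + int_cV R b.2))%:E |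
    b in [set b : 'cV[int]_n * 'cV[int]_m | 1 <= N1 (int_cV R b.1) <= t]].

Definition rescaled_psi Om t : \bar R :=
  ((t `^ (n%:R / m%:R))%:E * psi Om t)%E.

Definition Theta Om : \bar R := limf_esup (rescaled_psi Om) (pinfty_nbhs R).

Definition Theta_low Om : \bar R := limf_einf (rescaled_psi Om) (pinfty_nbhs R).

Definition DI c : set 'M[R]_(m, n) := [set Om | Theta Om = c%:E].

Definition Bad : set 'M[R]_(m, n) := [set Om | (0 < Theta_low Om)%E].

Definition FS c : set 'M[R]_(m, n) := DI c `\` Bad.

Definition Dirichlet_spectrum : set (\bar R) := range Theta.

End DirichletConstants.

Definition full_rank (R : realType) (m n : nat) : set 'M[R]_(m, n) :=
  [set Om | \rank Om = n].
Arguments full_rank {R m n}.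

(* On 'M[R]_(m, n) the library norm is the maximum norm of the entries; the
   Hausdorff dimension is the same for every norm. *)
Section Hausdorff.
Variables (R : realType) (V : normedModType R).
Implicit Types (E U : set V) (s d : R).

Definition diam U : \bar R :=
  ereal_sup [set `|p.1 - p.2|%:E | p in U `*` U].

(* Empty sets are left out of the sum, so that they contribute 0 also when
   s = 0. *)
Definition hausdorff_content s d E : \bar R :=
  ereal_inf [set (\sum_(0 <= i <oo | U i != set0) poweR (diam (U i)) s)%E |
    U in [set U : nat -> set V | E `<=` \bigcup_i U i /\
                                 forall i, (diam (U i) <= d%:E)%E]].

Definition hausdorff_measure s E : \bar R :=
  ereal_sup [set hausdorff_content s d E | d in [set d | 0 < d]].

Definition hausdorff_dim E : \bar R :=
  ereal_inf [set s%:E | s in [set s | 0 <= s /\ hausdorff_measure s E = 0%E]].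

End Hausdorff.

(* Main.v *)
From HB Require Import structures.
Require Import Defs.
From mathcomp Require Import all_boot all_order all_algebra.
From mathcomp Require Import all_classical all_reals all_analysis.
From mathcomp Require Import measurable_realfun ring lra zify.

Set Implicit Arguments.
Unset Strict Implicit.
Unset Printing Implicit Defensive.

Import Order.TTheory GRing.Theory Num.Theory.
Import numFieldNormedType.Exports.

Local Open Scope classical_set_scope.
Local Open Scope ring_scope.

(* Write n = 1 + q, w = n/m < 1 and Om = (xi | A), where xi is the first column,
   and let nu be the N1-norm of the first basis vector.

   The column xi is a limit of rational points P_k/q_k, with q_(k+1)/q_k tending
   to infinity, such that N2 (q_k xi - P_k) is close to c (nu q_(k+1))^(-w)
   while no positive denominator below q_(k+1) does better.  Alone this forces
   Theta Om <= c and Theta_low Om = 0.  The rational points come from a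
   multidimensional continued fraction: (q, P) is completed to a basis of
   Z^(1+m) whose other vectors, projected along (q, P), are nearly parallel to
   the coordinate axes.

   The entries of A are independent and uniform on [0, 1].  At the scale
   t = nu q_(k+1) there are O(t^n) integer vectors of N1-norm at most t that
   involve a column of A, and Om maps each of them into the c t^(-w)-ball around
   the integer vectors with probability O(c^m t^(-n)).  For small c, with
   probability at least 1/2 none of them does better than c t^(-w).  The matrices
   A for which this happens for infinitely many k hence have measure at least
   1/2, so that they have Hausdorff dimension m (n - 1), and Theta Om = c for all
   of them.  Adding a large integer multiple of the identity block to Om changes
   neither Theta nor the dimension, and it makes the rank equal to n. *)

(** * Independent uniform coordinates *)

Section TupleProbability.
Variable R : realType.

Let idR : measurableTypeR R -> R := idfun.

Let measurable_idR : measurable_fun setT idR.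
Proof. by move=> _ Y mY; rewrite setTI. Qed.

HB.instance Definition _ := isMeasurableFun.Build _ _ _ _ idR measurable_idR.

(* The uniform law of the library lives on a copy of [R] carrying another
   measurable display, from which it is transported here. *)
Definition unit_prob : probability R R :=
  distribution (uniform_prob (@ltr01 R)) idR.
Local Notation U := unit_prob.

Definition triangular_event k (w : nat -> nat -> R) (S : nat -> set R) :
    set (k.-tuple R) :=
  [set s | forall i, (i < k)%N -> S i (\sum_(l < k) w i l * tnth s l)].

Lemma measurable_triangular_event k w S : (forall i, measurable (S i)) ->
  measurable (triangular_event (k := k) w S).
Proof.
move=> mS.
have -> : triangular_event w S = \bigcap_(i in [set i | (i < k)%N])
    ((fun s : k.-tuple R => \sum_(l < k) w i l * tnth s l) @^-1` S i) by [].
apply: bigcap_measurableType => i _.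
rewrite -[X in measurable X]setTI.
apply: (@measurable_sum _ _ _ setT _ (index_enum 'I_k) (fun l s => w i l * tnth s l)) => // l.
by apply: measurable_funM => //; exact: measurable_tnth.
Qed.

(* If [w] is upper triangular, the [i]-th condition of the event constrains the
   [i]-th coordinate in terms of the later ones, and Fubini multiplies the bounds. *)
Definition triangular_bound k (mu : probability (k.-tuple R) R) : Prop :=
  forall (w : nat -> nat -> R) (S : nat -> set R) (e : nat -> R),
  (forall i l, (l < i)%N -> w i l = 0) -> (forall i, measurable (S i)) ->
  (forall i, 0 <= e i) ->
  (forall i y, ((forall l, (i < l)%N -> w i l = 0) -> y = 0) ->
    (U [set x | S i (w i i * x + y)%R] <= (e i)%:E)%E) ->
  (mu (triangular_event w S) <= (\prod_(i < k) e i)%:E)%E.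

(** Induction on the number of coordinates: the law is the product of the uniform law with the law
    of the tail, pushed forward by consing. Since column 0 of [w] vanishes below the diagonal, the
    conditions of index at least 1 form an event [F] on the tail alone. Over each tail in [F] the
    section has mass at most [e 0], and integrating over the tail gives the product. *)
Lemma exists_triangular_bound k :
  exists mu : probability (k.-tuple R) R, triangular_bound mu.
Proof.
elim: k => [|k [mu IH]].
  exists (@dirac _ (0.-tuple R) [tuple] R) => w S e _ _ _ _.
  by rewrite big_ord0 /= diracE lee_fin lern1 leq_b1.
pose T : (R * k.-tuple R)%type -> k.+1.-tuple R := fun p => [the _.-tuple _ of p.1 :: p.2].
have mT : measurable_fun setT T by exact: measurable_cons.
pose TT : {mfun _ >-> _} := HB.pack T (isMeasurableFun.Build _ _ _ _ T mT).
exists (distribution (U \x^ mu)%E TT) => w S e w0 mS e0 he.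
pose w' i l := w i.+1 l.+1; pose S' i := S i.+1; pose e' i := e i.+1.
pose F := triangular_event (k := k) w' S'.
have mF : measurable F by apply: measurable_triangular_event => i; exact: mS.
have HF : (mu F <= (\prod_(i < k) e' i)%:E)%E.
  apply: IH => [i l li|i|i|i y y0].
  - by rewrite /w' w0.
  - exact: mS.
  - exact: e0.
  - apply: he => wi; apply: y0 => l il; exact: wi.
pose E := T @^-1` (triangular_event w S).
have mE : measurable E.
  by rewrite -[E]setTI; apply: (mT) => //; exact: measurable_triangular_event.
rewrite /distribution /pushforward -/E /product_measure2.
have -> : (\prod_(i < k.+1) e i)%:E = (e 0%N * \prod_(i < k) e' i)%:E.
  by rewrite big_ord_recl.
apply: (@le_trans _ _ (\int[mu]_y ((e 0%N)%:E * (\1_F y)%:E))%E); last first.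
  rewrite ge0_integralZl//; first last.
  - by rewrite lee_fin.
  - exact/measurable_EFinP.
  by rewrite integral_indic// setIT EFinM lee_pmul// lee_fin.
change (\int[mu]_y (U \o ysection E) y <=
  \int[mu]_y ((e 0%N)%:E * (\1_F y)%:E))%E.
apply: ge0_le_integral => //.
- exact: measurable_fun_ysection.
- by apply: emeasurable_funM => //; exact/measurable_EFinP.
move=> y _ /=.
have TE (x : R) i : \sum_(l < k.+1) w i l * tnth (T (x, y)) l =
    w i 0%N * x + \sum_(l < k) w i l.+1 * tnth y l.
  rewrite big_ord_recl /= tnth0; congr (_ + _); apply: eq_bigr => l _.
  by rewrite tnthS.
rewrite indicE; have [yF|yF] := boolP (y \in F).
  rewrite mule1; apply: le_trans (he 0%N (\sum_(l < k) w 0%N l.+1 * tnth y l) _); last first.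
    by move=> w00; rewrite big1// => l _; rewrite w00// mul0r.
  apply: le_measure; rewrite ?inE.
  - exact: measurable_ysection.
  - rewrite -[X in measurable X]setTI.
    have : measurable_fun setT
        (fun x : R => w 0%N 0%N * x + \sum_(l < k) w 0%N l.+1 * tnth y l).
      by apply: measurable_funD => //; exact: measurable_funM.
    by apply => //; exact: mS.
  - move=> x; rewrite /ysection /= inE => /(_ 0%N isT).
    by rewrite TE.
(* Off [F] a condition on the tail fails whatever the first coordinate is, so the section is
   empty. *)
rewrite mule0 [X in U X](_ : _ = set0) ?measure0//.
apply/seteqP; split => // x; rewrite /ysection /= inE => Exy.
move/negP: yF; apply; rewrite inE => i ik.
have := Exy i.+1 ik; rewrite TE /S'.
by rewrite w0// mul0r add0r.
Qed.
End TupleProbability.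

Section UnitProb.
Variable R : realType.
Local Notation U := (@unit_prob R).

Lemma unit_prob_itv (a b : R) : a <= b -> (U `[a, b]%classic <= (b - a)%:E)%E.
Proof.
move=> ab; rewrite /unit_prob /distribution /pushforward /= /uniform_prob.
set A := (X in integral _ X); have AE : A = `[a, b]%classic by [].
rewrite AE.
have mab : measurable (`[a, b]%classic : set (measurableTypeR R)) by exact: measurable_itv.
apply: (@le_trans _ _ (\int[lebesgue_measure]_(x in `[a, b]) 1)%E).
  apply: ge0_le_integral => //.
  - by move=> x _; rewrite lee_fin uniform_pdf_ge0.
  - by apply/measurable_EFinP/measurable_funTS; exact: measurable_uniform_pdf.
  - move=> x _; rewrite lee_fin /uniform_pdf subr0 invr1.
    by case: ifP.
rewrite integral_cst// mul1e.
have /= H := lebesgue_measure_itv `[a, b]; rewrite [X in (X <= _)%E]H lte_fin.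
by case: ifP => // _; rewrite lee_fin subr_ge0.
Qed.

Lemma unit_prob_setC01 : U (~` `[0, 1]%classic) = 0%E.
Proof.
rewrite /unit_prob /distribution /pushforward /= /uniform_prob.
rewrite integral_uniform_pdf (_ : _ `&` _ = set0) ?integral_set0//.
by apply/seteqP; split => x //= [].
Qed.

Lemma measurable_near_int (beta eps : R) :
  measurable [set z : R | exists p : int, `|z + beta + p%:~R| <= eps].
Proof.
have -> : [set z : R | exists p : int, `|z + beta + p%:~R| <= eps] =
    \bigcup_(p : int) `[- beta - p%:~R - eps, - beta - p%:~R + eps]%classic.
  apply/seteqP; split => [z [p]|z [p _] /=] h.
    by exists p => //=; move: h; rewrite in_itv /= ler_norml => /andP[]; lra.
  by exists p; move: h; rewrite in_itv /= ler_norml => /andP[]; lra.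
apply: countable_bigcupT_measurable => [|p]; last exact: measurable_itv.
exact: countableP.
Qed.

(** Inside [0, 1] the set is covered by [n + 2] intervals of length [2 * eps / n], where [n] = |b|,
    and [n + 2 <= 3 * n]. The bound does not depend on [b] or [beta], as the later union bound
    requires. *)
Lemma unit_prob_near_int (b : int) (beta eps : R) : b != 0 -> 0 <= eps ->
  (U [set x | exists p : int, `|b%:~R * x + beta + p%:~R| <= eps]%R
     <= (6 * eps)%:E)%E.
Proof.
move=> b0 eps0.
wlog bgt0 : b beta b0 / 0 < b => [hw|].
  have [|bn0] := ltrP 0 b; first exact: hw.
  rewrite [X in U X](_ : _ =
      [set x | exists p : int, `|(- b)%:~R * x + - beta + p%:~R| <= eps]).
    by apply: hw; rewrite ?oppr_eq0// oppr_gt0 lt_neqAle b0.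
  apply/seteqP; split => x [p px]; exists (- p).
    by rewrite !mulrNz mulNr -!opprD normrN.
  by rewrite -normrN; move: px; rewrite !mulrNz mulNr !opprD !opprK.
(* A bound of at least 1 is trivial; otherwise [eps] is below 1/6, which limits the integers that
   can be reached to [n + 2]. *)
have [e1|e1] := lerP 1 (6 * eps).
  apply: le_trans (_ : (_ <= 1)%E) _; last by rewrite lee_fin.
  apply: probability_le1.
  have := measurable_near_int beta eps.
  set S := (X in measurable X) => mS.
  have mf : measurable_fun setT (fun x : R => b%:~R * x) by exact: measurable_funM.
  by have := mf measurableT _ mS; rewrite setTI.
case: b bgt0 {b0} => // n n0.
have n0' : 0 < (n%:R : R) by rewrite ltr0n.
pose c j : R := (Num.floor beta)%:~R + j%:R - beta.
(* Index 0 collects the points outside [0, 1], of mass zero; index [j + 1] is the interval around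
   the solution of [n * x + beta = floor beta + j]. *)
pose I j : set R := if j is j.+1 then `[(c j - eps) / n%:R, (c j + eps) / n%:R]%classic
  else ~` `[0, 1]%classic.
set A := [set x | _].
have mI j : measurable (I j).
  case: j => [|j]; first by apply: measurableC; exact: measurable_itv.
  exact: measurable_itv.
have mA : measurable A.
  have := measurable_near_int beta eps.
  set S := (X in measurable X) => mS.
  have mf : measurable_fun setT (fun x : R => n%:R * x) by exact: measurable_funM.
  by have := mf measurableT _ mS; rewrite setTI.
apply: (@le_trans _ _ (\sum_(j < n.+3) U (I j))%E).
  apply: content_subadditive => //.
  move=> x [p px]; rewrite -bigcup_mkord.
  rewrite -pmulrn in px.
  have [x01|x01] := boolP (x \in `[0, 1]%classic); last first.
    by exists 0%N => //=; rewrite notin_setE in x01.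
  move: x01; rewrite inE /= in_itv /= => /andP[x0 x1].
  have /andP[fb1 fb2] := floor_itv beta.
  pose j := - p - Num.floor beta.
  have nx0 : 0 <= n%:R * x by rewrite mulr_ge0// ltW.
  have nx1 : n%:R * x <= n%:R by rewrite ler_piMr// ltW.
  have jE : (j%:~R : R) = - p%:~R - (Num.floor beta)%:~R by rewrite rmorphB/= rmorphN.
  rewrite intrD1 in fb2.
  have /andP[px1 px2] : - eps <= n%:R * x + beta + p%:~R <= eps.
    by rewrite -ler_norml.
  have j0 : (-1 < j) by rewrite -(ltr_int R) jE; lra.
  have jn : (j < n.+2%:Z).
    by rewrite -(ltr_int R) jE -pmulrn -natr1 -natr1; lra.
  case: j jE j0 jn => // j jE _ jn.
  exists j.+1; first by rewrite /= ltnS.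
  by rewrite /= in_itv /= ler_pdivrMr// ler_pdivlMr// [x * _]mulrC /c -pmulrn in jE *; lra.
rewrite big_ord_recl /= unit_prob_setC01 add0e.
apply: (@le_trans _ _ (\sum_(j < n.+2) (2 * eps / n%:R)%:E)%E).
  apply: lee_sum => j _; apply: le_trans (unit_prob_itv _) _.
    by rewrite ler_pM2r ?invr_gt0//; lra.
  by rewrite lee_fin -mulrBl ler_pM2r ?invr_gt0//; lra.
rewrite sumEFin lee_fin sumr_const card_ord -[X in X <= _]mulr_natl mulrA ler_pdivrMr//.
have n1 : 1 <= (n%:R : R) by rewrite ler1n -(ltr0n R).
rewrite -natr1 -natr1; nra.
Qed.

End UnitProb.

Section TriangularBound.
Variables (R : realType) (k : nat) (mu : probability (k.-tuple R) R).
Hypothesis mu_tri : triangular_bound mu.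
Local Notation U := (@unit_prob R).

Let delta (i l : nat) : R := (i == l)%:R.

Let deltaE (s : k.-tuple R) i (ik : (i < k)%N) :
  \sum_(l < k) delta i l * tnth s l = tnth s (Ordinal ik).
Proof.
rewrite (bigD1 (Ordinal ik)) //= /delta eqxx mul1r big1 ?addr0// => l li.
by rewrite eq_sym (negbTE (_ : nat_of_ord l != i)) ?mul0r.
Qed.

Let boxE (u : k.-tuple R) (r : R) :
  [set s : k.-tuple R | forall i, `|tnth s i - tnth u i| <= r] =
  triangular_event delta (fun i => `[nth 0 u i - r, nth 0 u i + r]%classic).
Proof.
apply/seteqP; split => s /= h i.
  move=> ik; rewrite deltaE /= in_itv /=.
  have := h (Ordinal ik); rewrite [tnth u _](tnth_nth 0) /= ler_norml => /andP[].
  lra.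
have := h i (ltn_ord i); rewrite deltaE /= in_itv [tnth u _](tnth_nth 0) ler_norml.
rewrite (_ : Ordinal _ = i); last exact: val_inj.
by move=> /= /andP[]; lra.
Qed.

Lemma measurable_box (u : k.-tuple R) (r : R) :
  measurable [set s : k.-tuple R | forall i, `|tnth s i - tnth u i| <= r].
Proof.
by rewrite boxE; apply: measurable_triangular_event => i; exact: measurable_itv.
Qed.

Lemma tuple_prob_box (u : k.-tuple R) (r : R) : 0 <= r ->
  (mu [set s : k.-tuple R | forall i, `|tnth s i - tnth u i| <= r]%R
     <= ((2 * r) ^+ k)%:E)%E.
Proof.
move=> r0; rewrite boxE.
have -> : (2 * r) ^+ k = \prod_(i < k) (2 * r) by rewrite prodr_const card_ord.
apply: (mu_tri (e := fun=> 2 * r)) => [i l li|i|i|i y _].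
- by rewrite /delta gtn_eqF.
- exact: measurable_itv.
- by rewrite mulr_ge0.
- rewrite /delta eqxx.
  rewrite [X in U X](_ : _ = `[nth 0 u i - r - y, nth 0 u i + r - y]%classic).
    by apply: le_trans (unit_prob_itv _) _; rewrite ?lee_fin; lra.
  by apply/seteqP; split => x; rewrite /= !in_itv /= mul1r => /andP[]; lra.
Qed.

Lemma measurable_cube :
  measurable [set s : k.-tuple R | forall i, 0 <= tnth s i <= 1].
Proof.
have -> : [set s : k.-tuple R | forall i, 0 <= tnth s i <= 1] =
    [set s : k.-tuple R | forall i, `|tnth s i - tnth [tuple 2^-1 | _ < k] i| <= 2^-1].
  apply/seteqP; split => s /= h i; have := h i; rewrite tnth_mktuple ler_norml.
    by move=> /andP[]; lra.
  by move=> /andP[]; lra.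
exact: measurable_box.
Qed.

(** For each [i], the event that coordinate [i] leaves [0, 1] is triangular for the identity matrix,
    and its bound has a zero factor at [i]. *)
Lemma tuple_prob_cubeC :
  mu (~` [set s : k.-tuple R | forall i, 0 <= tnth s i <= 1]) = 0%E.
Proof.
pose S (i j : nat) : set R := if i == j then ~` `[0, 1]%classic else setT.
have mS i j : measurable (S i j).
  by rewrite /S; case: ifP => // _; apply: measurableC; exact: measurable_itv.
pose F (i : nat) : set (k.-tuple R) := triangular_event delta (S i).
apply/eqP; rewrite eq_le measure_ge0 andbT.
apply: (@le_trans _ _ (\sum_(i < k) mu (F i))%E).
  apply: (@content_subadditive _ _ _ mu _ F).
  - by move=> i _; apply: measurable_triangular_event.
  - by apply: measurableC; exact: measurable_cube.
  rewrite -(bigcup_mkord k F) => s /existsNP[i si]; exists i => //= j jk.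
  rewrite deltaE /S; case: eqP => // ij; rewrite /= in_itv /=.
  by move: si; rewrite (_ : Ordinal _ = i)//; exact: val_inj.
rewrite big1// => i _; apply/eqP; rewrite eq_le measure_ge0 andbT.
pose e (j : nat) : R := (nat_of_ord i != j)%:R.
have -> : 0%E = (\prod_(j < k) e j)%:E.
  by rewrite (bigD1 i)//= /e eqxx mul0r.
apply: (mu_tri (w := delta) (S := S i) (e := e)) => // [j l lj|j y y0].
- by rewrite /delta gtn_eqF.
- have mSx : measurable [set x : R | S i j (delta j j * x + y)].
    have mf : measurable_fun setT (fun x : R => delta j j * x + y).
      by apply: measurable_funD => //; exact: measurable_funM.
    by have := mf measurableT _ (mS i j); rewrite setTI.
  rewrite /e; have [ij|ij] := eqVneq; last exact: probability_le1.
  (* Row [i] is diagonal, so the shift [y] is 0; the complement of [0, 1] would not stay null under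
     an arbitrary shift. *)
  rewrite -ij /S eqxx /delta eqxx y0 => [|l il]; last first.
    by rewrite -ij in il; rewrite /delta -ij ltn_eqF.
  by rewrite [X in U X](_ : _ = ~` `[0, 1]%classic) ?unit_prob_setC01//;
    apply/seteqP; split => x; rewrite /= mul1r addr0.
Qed.

End TriangularBound.

(** * Random matrices and lower bounds for the dimension *)

Lemma normM_coord_le (R : realType) m n (M : 'M[R]_(m, n)) i j : `|M i j| <= `|M|.
Proof.
rewrite [leRHS]/Num.norm /= mx_normrE.
exact: (le_bigmax _ (fun ij => `|M ij.1 ij.2|) (i, j)).
Qed.

Lemma normM_le (R : realType) m n (M : 'M[R]_(m, n)) r :
  0 <= r -> (forall i j, `|M i j| <= r) -> `|M| <= r.
Proof.
move=> r0 h; rewrite [leLHS]/Num.norm /= mx_normrE.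
by apply: bigmax_le => // -[i j] _; exact: h.
Qed.

Section MatrixOfTuple.
Variables (R : realType) (m p : nat).
Local Notation d := (m * p.+1)%N.
Local Notation U := (@unit_prob R).

Definition matrix_of_tuple (s : d.-tuple R) : 'M[R]_(m, p.+1) :=
  \matrix_(i, j) nth 0 s (i * p.+1 + j).

Let pos_lt (i : 'I_m) (j : 'I_p.+1) : (i * p.+1 + j < d)%N.
Proof.
apply: (@leq_trans (i.+1 * p.+1)); rewrite ?leq_mul2r ?ltn_ord ?orbT//.
by rewrite mulSn addnC ltn_add2r.
Qed.

Let pos i j : 'I_d := Ordinal (pos_lt i j).

Let pos_div (i : 'I_m) (j : 'I_p.+1) : ((i * p.+1 + j) %/ p.+1 = i)%N.
Proof. by rewrite divnMDl// divn_small ?addn0. Qed.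

Let pos_mod (i : 'I_m) (j : 'I_p.+1) : ((i * p.+1 + j) %% p.+1 = j)%N.
Proof. by rewrite modnMDl modn_small. Qed.

Lemma matrix_of_tuple_dist (s s' : d.-tuple R) (l : 'I_d) :
  `|tnth s l - tnth s' l| <= `|matrix_of_tuple s - matrix_of_tuple s'|.
Proof.
have ltd : (l %/ p.+1 < m)%N by rewrite ltn_divLR.
have ltm : (l %% p.+1 < p.+1)%N by rewrite ltn_pmod.
have le : (l = Ordinal ltd * p.+1 + Ordinal ltm :> nat)%N by rewrite -divn_eq.
have := normM_coord_le (matrix_of_tuple s - matrix_of_tuple s') (Ordinal ltd) (Ordinal ltm).
by rewrite !mxE -le -!tnth_nth.
Qed.

Variable mu : probability (d.-tuple R) R.
Hypothesis mu_tri : triangular_bound mu.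

Definition rows_near_int (b : 'cV[int]_p.+1) (beta : 'cV[R]_m) (eps : R) :
    set (d.-tuple R) :=
  [set s | forall i, exists q : int,
     `|((matrix_of_tuple s *m int_cV R b) + beta) i ord0 + q%:~R| <= eps].

(** The condition on coordinate [i] of the product with [b] is stored at the position of the matrix
    entry [(i, j0)]; all other rows are zero. When [j0] is the first index with a nonzero entry of
    [b], this system is upper triangular with the nonzero integer [b j0] on the active diagonal
    places. *)
Let w (b : 'cV[int]_p.+1) (j0 : 'I_p.+1) (P l : nat) : R :=
  if (P %% p.+1 == j0)%N && (l %/ p.+1 == P %/ p.+1)%N
  then (b (inord (l %% p.+1)) ord0)%:~R else 0.

Let wE b j0 (i : 'I_m) (s : d.-tuple R) :
  \sum_(l < d) w b j0 (pos i j0) l * tnth s l =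
  (matrix_of_tuple s *m int_cV R b) i ord0.
Proof.
rewrite mxE (bigID (fun l : 'I_d => l %/ p.+1 == i)%N) /= [X in _ + X]big1 ?addr0; last first.
  by move=> l li; rewrite /w pos_div (negbTE li) andbF mul0r.
rewrite (reindex_onto (pos i) (fun l => inord (l %% p.+1))) /=; last first.
  move=> l /eqP li; apply/val_inj; rewrite /= -li inordK ?ltn_pmod//.
  by rewrite -divn_eq.
apply: eq_big => [j|j _].
  by rewrite pos_div pos_mod inord_val !eqxx.
rewrite /w /= !pos_div !pos_mod !eqxx /= inord_val !mxE mulrC.
by rewrite [tnth _ _](tnth_nth 0).
Qed.

(** Idle rows get the full line, hence no constraint. The default 0 stands for [beta] at positions
    beyond the last row. *)
Let S (beta : 'cV[R]_m) (j0 : 'I_p.+1) eps (P : nat) : set R :=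
  if (P %% p.+1 == j0)%N then
    [set z : R | exists q : int,
       `|z + (if insub (P %/ p.+1)%N is Some i then beta i ord0 else 0) + q%:~R| <= eps]
  else setT.

Let rowsE b beta eps (j0 : 'I_p.+1) :
  rows_near_int b beta eps = triangular_event (w b j0) (S beta j0 eps).
Proof.
apply/seteqP; split => s /= h.
  move=> P Pd; rewrite /S; case: eqP => // Pj0.
  have ltd : (P %/ p.+1 < m)%N by rewrite ltn_divLR.
  have PE : P = (pos (Ordinal ltd) j0) :> nat by rewrite /= -Pj0 -divn_eq.
  rewrite insubT.
  have -> : \sum_(l < d) w b j0 P l * tnth s l =
      (matrix_of_tuple s *m int_cV R b) (Ordinal ltd) ord0.
    by rewrite -(wE b j0); apply: eq_bigr => l _; rewrite -PE.
  by have [q] := h (Ordinal ltd); rewrite mxE; exists q.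
move=> i; have := h (pos i j0) (ltn_ord _).
rewrite wE /S /= pos_div pos_mod eqxx (insubT (fun x => (x < m)%N) (ltn_ord i)) /=.
rewrite (_ : Sub _ _ = i); last exact: val_inj.
by case=> q hq; exists q; rewrite mxE.
Qed.

Lemma measurable_rows_near_int b beta eps : measurable (rows_near_int b beta eps).
Proof.
rewrite (rowsE _ _ _ ord0); apply: measurable_triangular_event => i.
by rewrite /S; case: ifP => // _; exact: measurable_near_int.
Qed.

(** With the other entries fixed, the entry in column [j0] of each row brings that coordinate near
    an integer with probability at most [6 * eps]. There are [m] active rows, and the idle ones
    contribute a factor 1. *)
Lemma tuple_prob_rows b beta eps : b != 0 -> 0 <= eps ->
  (mu (rows_near_int b beta eps) <= ((6 * eps) ^+ m)%:E)%E.
Proof.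
move=> b0 eps0.
have [j bj] : exists j, b j ord0 != 0.
  apply/existsP; apply: contraNT b0 => /existsPn h.
  by apply/eqP/matrixP => i j; rewrite ord1 mxE; exact/eqP/negPn/h.
have [j0 bj0 j0min] :=
  @arg_minnP _ j (fun j => b j ord0 != 0) (fun j : 'I_p.+1 => nat_of_ord j) bj.
rewrite (rowsE _ _ _ j0).
pose e (P : nat) : R := if (P %% p.+1 == j0)%N then 6 * eps else 1.
have -> : (6 * eps) ^+ m = \prod_(P < d) e P.
  rewrite (bigID (fun P : 'I_d => P %% p.+1 == j0)%N) /= [X in _ = _ * X]big1 ?mulr1; last first.
    by move=> P; rewrite /e => /negbTE ->.
  have ltd (P : 'I_d) : (P %/ p.+1 < m)%N by rewrite ltn_divLR.
  rewrite (reindex_onto (pos^~ j0) (fun P => Ordinal (ltd P))) /=; last first.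
    by move=> P /eqP Pj0; apply/val_inj; rewrite /= -Pj0 -divn_eq.
  rewrite (eq_big predT (fun=> 6 * eps)) => [|i|i _].
  - by rewrite prodr_const card_ord.
  - by rewrite pos_mod eqxx; apply/eqP/val_inj; rewrite /= pos_div.
  - by rewrite /e pos_mod eqxx.
apply: (mu_tri (w := w b j0) (S := S beta j0 eps) (e := e)) => [P l lP|P|P|P y _].
- rewrite /w; case: ifP => // /andP[/eqP Pj0 /eqP lPd].
  have [bl|/negPn/eqP -> //] := boolP (b (inord (l %% p.+1)) ord0 != 0).
  have := j0min _ bl; rewrite inordK ?ltn_pmod// -Pj0.
  move: lP; rewrite {1}(divn_eq l p.+1) {1}(divn_eq P p.+1) lPd ltn_add2l.
  by rewrite ltnNge => /negbTE ->.
- by rewrite /S; case: ifP => // _; exact: measurable_near_int.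
- by rewrite /e; case: ifP => // _; rewrite mulr_ge0.
rewrite /e /S; case: (boolP (P %% p.+1 == j0)%N) => Pj0; last first.
  by rewrite [X in U X](_ : _ = setT) ?probability_setT//; apply/seteqP; split.
rewrite /w Pj0 eqxx /=; have := unit_prob_near_int
  (y + (if insub (P %/ p.+1)%N is Some i then beta i ord0 else 0)) bj0 eps0.
congr (_ <= _)%E; congr (U _); apply/seteqP.
by rewrite (eqP Pj0) inord_val; split => x [q hq]; exists q; move: hq; rewrite !addrA.
Qed.
End MatrixOfTuple.

(* The mass distribution principle: a set of diameter r has a preimage contained
   in a cube of side 2 r. *)
Lemma hausdorff_dim_image_ge (R : realType) (V : normedModType R) (k : nat)
    (mu : probability (k.-tuple R) R) (f : k.-tuple R -> V) (G : set (k.-tuple R)) :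
  triangular_bound mu ->
  (forall s s' i, `|tnth s i - tnth s' i| <= `|f s - f s'|) ->
  measurable G -> (0 < mu G)%E ->
  (k%:R%:E <= hausdorff_dim (f @` G))%E.
Proof.
move=> mu_tri f_dist mG muG0.
apply: le_ereal_inf_tmp => _ [s [s0 Hs] <-]; rewrite lee_fin leNgt; apply/negP => sk.
have content0 : hausdorff_content s 1 (f @` G) = 0%E.
  apply/eqP; rewrite eq_le; apply/andP; split; last first.
    apply: le_ereal_inf_tmp => _ [W _ <-].
    by apply: nneseries_ge0 => i _ _; exact: poweR_ge0.
  by rewrite -Hs; apply: ereal_sup_ubound; exists 1 => //=.
have muGfin : mu G \is a fin_num by rewrite fin_num_measure.
pose g := fine (mu G); have gE : mu G = g%:E by rewrite fineK.
have g0 : 0 < g by rewrite -lte_fin -gE.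
(* The divisor [2 ^+ k] pays for replacing a set of diameter r by a cube of side 2 r. *)
have : (hausdorff_content s 1 (f @` G) < (g / 2 ^+ k)%:E)%E.
  by rewrite content0 lte_fin divr_gt0.
move=> /ereal_inf_lt[_ [W [GW Wd] <-]] Wlt.
pose r i := fine (diam (W i)).
(* The cube is centred at an arbitrary preimage of a point of [W i]; unlike the preimage of [W i]
   itself, it is certainly measurable. *)
pose B i : set (k.-tuple R) :=
  if pselect (exists h, W i (f h)) is left ex
  then [set t | forall l, `|tnth t l - tnth (projT1 (cid ex)) l| <= r i] else set0.
have mB i : measurable (B i).
  by rewrite /B; case: pselect => // ?; exact: measurable_box.
have diamP i x y : W i x -> W i y -> `|x - y| <= r i /\ (diam (W i) = (r i)%:E).
  move=> Wx Wy; have h : (`|x - y|%:E <= diam (W i))%E.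
    by apply: ereal_sup_ubound; exists (x, y).
  have dfin : diam (W i) \is a fin_num.
    rewrite fin_real//; apply/andP; split.
      by apply: lt_le_trans h; rewrite ltNyr.
    by apply: le_lt_trans (Wd i) _; rewrite ltry.
  by rewrite /r fineK//; split => //; rewrite -lee_fin fineK.
have GB : G `<=` \bigcup_i B i.
  move=> h Gh; have [i _ Wi] := GW (f h) (imageP _ Gh).
  exists i => //; rewrite /B; case: pselect => [ex'|]; last by case; exists h.
  move=> l; apply: le_trans (f_dist _ _ _) _.
  by case: cid => h' Wh' /=; have [] := diamP i _ _ Wi Wh'.
have muB i : (mu (B i) <= if W i != set0 then (2 ^+ k)%:E * poweR (diam (W i)) s else 0)%E.
  rewrite /B; case: pselect => [[h Wh]|nex]; last first.
    by rewrite measure0; case: ifP => // _; rewrite mule_ge0// ?poweR_ge0// lee_fin exprn_ge0.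
  have [rh dE] := diamP _ _ _ Wh Wh.
  rewrite subrr normr0 in rh.
  have -> : W i != set0 by apply/set0P; exists (f h).
  apply: le_trans (tuple_prob_box mu_tri _ rh) _.
  rewrite dE poweR_EFin -EFinM lee_fin exprMn ler_pM2l ?exprn_gt0//.
  have r1 : r i <= 1 by rewrite -lee_fin -dE.
  (* As diameters are at most 1, [s < k] gives r^k <= r^s for r > 0. For r = 0 the left side
     vanishes because [k] is positive. *)
  have [->|rn0] := eqVneq (r i) 0.
    have k0 : (0 < k)%N by rewrite -(ltr0n R) (le_lt_trans s0).
    by rewrite expr0n eqn0Ngt k0 powR_ge0.
  have rp : 0 < r i by rewrite lt_neqAle eq_sym rn0.
  by rewrite -powR_mulrn// ger_powR// ?rp// ltW.
have : (mu G <= \sum_(0 <= i <oo) mu (B i))%E.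
  exact: measure_sigma_subadditive.
apply/negP; rewrite -ltNge.
apply: (@le_lt_trans _ _
  ((2 ^+ k)%:E * \sum_(0 <= i <oo | W i != set0) poweR (diam (W i)) s)%E).
  rewrite -nneseriesZl; last by move=> *; exact: poweR_ge0.
  rewrite [leRHS]eseries_mkcond; apply: lee_nneseries => i _; last exact: muB.
  by move=> _; exact: measure_ge0.
rewrite gE; move: Wlt; rewrite -(@lte_pmul2l _ (2 ^+ k)%:E)// ?lte_fin ?exprn_gt0//.
by move=> /lt_le_trans; apply; rewrite -EFinM lee_fin mulrC divfK// expf_neq0.
Qed.

(** * Norms on column vectors *)

Section Norm.
Variables (R : realType) (k : nat) (N : 'cV[R]_k -> R).
Hypothesis N_norm : is_norm N.

Lemma is_norm_triangle x y : N (x + y) <= N x + N y.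
Proof. by case: N_norm. Qed.

Lemma is_normZ a x : N (a *: x) = `|a| * N x.
Proof. by case: N_norm. Qed.

Lemma is_norm0 : N 0 = 0.
Proof. by rewrite -(scale0r 0) is_normZ normr0 mul0r. Qed.

Lemma is_normN x : N (- x) = N x.
Proof. by rewrite -scaleN1r is_normZ normrN1 mul1r. Qed.

Lemma is_norm_ge0 x : 0 <= N x.
Proof.
have := is_norm_triangle x (- x); rewrite subrr is_norm0 is_normN.
by rewrite -mulr2n pmulrn_lge0.
Qed.

Lemma is_norm_gt0 x : x != 0 -> 0 < N x.
Proof.
move=> x0; rewrite lt_neqAle is_norm_ge0 andbT eq_sym.
by apply: contraNneq x0; case: N_norm => _ _ h /h ->.
Qed.

Lemma is_norm_sum I (r : seq I) (P : pred I) (F : I -> 'cV[R]_k) :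
  N (\sum_(i <- r | P i) F i) <= \sum_(i <- r | P i) N (F i).
Proof.
elim/big_ind2: _ => [|x1 x2 y1 y2 h1 h2|//]; first by rewrite is_norm0.
by apply: le_trans (is_norm_triangle _ _) _; exact: lerD.
Qed.

Lemma is_norm_upper : exists2 K, 0 < K & forall x, N x <= K * `|x|.
Proof.
exists (1 + \sum_(i < k) N (delta_mx i ord0)).
  by rewrite ltr_wpDr// sumr_ge0// => i _; exact: is_norm_ge0.
move=> x; rewrite [in leLHS](matrix_sum_delta x).
apply: le_trans (is_norm_sum _ _ _) _.
rewrite mulrDl mul1r ler_wpDl// mulr_suml; apply: ler_sum => i _.
rewrite big_ord1 is_normZ mulrC ler_wpM2l ?is_norm_ge0//.
exact: normM_coord_le.
Qed.

Lemma is_norm_dist x y : `|N x - N y| <= N (x - y).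
Proof.
rewrite ler_norml; apply/andP; split.
  have := is_norm_triangle x (y - x); rewrite addrC subrK -(is_normN (y - x)) opprB; lra.
have := is_norm_triangle y (x - y); rewrite addrC subrK; lra.
Qed.

(** By [is_norm_upper] the norm is continuous, so it attains a minimum on the compact unit sphere of
    the maximum norm, and that minimum is positive. Vectors are transposed to rows to apply
    [bounded_closed_compact]; dimension 0, where the sphere is empty, is treated apart. *)
Lemma is_norm_lower : exists2 kappa, 0 < kappa & forall x, kappa * `|x| <= N x.
Proof.
have [K K0 NK] := is_norm_upper.
have [k0|k0] := posnP k.
  exists 1 => // x; suff -> : x = 0 by rewrite normr0 mulr0 is_norm0.
  by apply/matrixP => i; have := ltn_ord i; rewrite {2}k0.
pose f (x : 'rV[R]_k) := N x^T.
pose A := [set x : 'rV[R]_k | `|x| = 1].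
have normT (x : 'cV[R]_k) : `|x^T| = `|x|.
  apply/eqP; rewrite eq_le; apply/andP; split; apply: normM_le => // i j.
    by rewrite mxE normM_coord_le.
  by have := normM_coord_le x^T j i; rewrite mxE.
have normT' (x : 'rV[R]_k) : `|x^T| = `|x| by rewrite -normT trmxK.
have cf : continuous f.
  move=> x; have FF := @nbhs_filter 'rV[R]_k x; apply/(@cvgrPdist_le _ _ _ (nbhs x)) => e e0.
  apply/nbhs_ballP; exists (K^-1 * e); rewrite /= ?mulr_gt0 ?invr_gt0// => y [_ xy].
  rewrite /f; apply: le_trans (is_norm_dist _ _) _; apply: le_trans (NK _) _.
  rewrite -linearB /= normT' -ler_pdivlMl//.
  apply: normM_le => [|i l]; first by rewrite ltW// mulr_gt0 ?invr_gt0.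
  by rewrite !mxE ltW//; exact: xy.
have A0 : A !=set0.
  exists (const_mx 1); apply/eqP; rewrite eq_le; apply/andP; split.
    by apply: normM_le => // i j; rewrite mxE normr1.
  by have := normM_coord_le (const_mx 1 : 'rV[R]_k) ord0 (Ordinal k0); rewrite mxE normr1.
have cA : compact A.
  apply: bounded_closed_compact.
    exists 1; split; first exact: num_real.
    by move=> y y1 x /= ->; exact: ltW.
  rewrite (_ : A = (fun x : 'rV[R]_k => `|x|) @^-1` [set 1])//.
  apply: closed_comp; last exact: closed_eq.
  by move=> x _; exact: norm_continuous.
have [c] := compact_EVT_min A0 cA (continuous_subspaceT cf).
rewrite inE => Ac cmin.
exists (f c).
  apply: is_norm_gt0; rewrite -(inj_eq (@trmx_inj _ _ _)) trmxK trmx0 -normr_eq0.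
  by rewrite Ac oner_eq0.
move=> x; have [->|x0] := eqVneq x 0; first by rewrite normr0 mulr0 is_norm0.
have nx : 0 < `|x| by rewrite normr_gt0.
rewrite -ler_pdivlMr//.
have := cmin (`|x|^-1 *: x^T); rewrite inE /A /= normrZ normT normfV normr_id mulVf ?gt_eqF//.
by move=> /(_ erefl) /le_trans; apply; rewrite /f linearZ /= trmxK is_normZ normfV normr_id mulrC.
Qed.
End Norm.

(** * Integer vectors that involve the random columns *)

Lemma probability_lim_sup_ge d (T : measurableType d) (R : realType)
    (mu : probability T R) (F : (set T)^nat) (a : \bar R) :
  (forall k, measurable (F k)) -> (forall k, (a <= mu (F k))%E) ->
  (a <= mu (lim_sup_set F))%E.
Proof.
move=> mF aF.
have mU n : measurable (\bigcup_(k >= n) F k) by apply: bigcup_measurable.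
(* Continuity from above: the tail unions decrease to the limit superior, and each of them has
   measure at least [a]. *)
have cvgF := lim_sup_set_cvg mu F mF
  (le_lt_trans (probability_le1 mu (mU 0%N)) (ltry _)).
rewrite -(cvg_lim _ cvgF)//; apply: lime_ge; first by apply/cvg_ex; eexists; exact: cvgF.
near=> n; apply: le_trans (aF n) _; apply: le_measure; rewrite ?inE//.
by apply: (bigcup_sup (i := n)) => /=.
Unshelve. all: by end_near. Qed.

Lemma measure_bigsetU_le d (T : measurableType d) (R : realType)
    (mu : {measure set T -> \bar R}) (I : finType) (P : pred I) (F : I -> set T) :
  (forall i, measurable (F i)) ->
  (mu (\big[setU/set0]_(i | P i) F i) <= \sum_(i | P i) mu (F i))%E.
Proof.
move=> mF.
suff [] : measurable (\big[setU/set0]_(i | P i) F i) /\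
  (mu (\big[setU/set0]_(i | P i) F i) <= \sum_(i | P i) mu (F i))%E by [].
elim/big_rec2 : _ => [|i x A _ [mA Ax]]; first by rewrite measure0.
split; first exact: measurableU.
by apply: le_trans (measureU2 _ _ _) _ => //; rewrite leeD2l.
Qed.

Definition extended_matrix (R : realType) m p (xi : 'cV[R]_m) (s : (m * p.+1).-tuple R) :
  'M[R]_(m, 1 + p.+1) := row_mx xi (matrix_of_tuple s).

(** Union bound over the [b1] with nonzero lower part. For each of them, an N2-norm below [delta]
    puts every coordinate within [delta / kappa] of an integer, the contribution of [xi] being a
    fixed shift and [b2] supplying the integers. *)
Lemma exists_far_from_int (R : realType) (m p : nat)
    (mu : probability ((m * p.+1).-tuple R) R)
    (N1 : 'cV[R]_(1 + p.+1) -> R) (N2 : 'cV[R]_m -> R) (C kappa t delta : R)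
    (xi : 'cV[R]_m) :
  triangular_bound mu -> 0 < C -> 0 < kappa -> 1 <= t -> 0 <= delta ->
  (forall x, `|x| <= C * N1 x) -> (forall x, kappa * `|x| <= N2 x) ->
  exists G : set ((m * p.+1).-tuple R), [/\ measurable G,
    (mu (~` G) <= (((2 * C + 3) * t) ^+ (1 + p.+1) * (6 * (delta / kappa)) ^+ m)%:E)%E &
    forall s, G s -> forall (b1 : 'cV[int]_(1 + p.+1)) (b2 : 'cV[int]_m),
      dsubmx b1 != 0 -> N1 (int_cV R b1) <= t ->
      delta <= N2 (extended_matrix xi s *m int_cV R b1 + int_cV R b2)].
Proof.
move=> mu_tri C0 kappa0 t1 delta0 N1C N2k.
have Ct0 : 0 <= C * t by rewrite mulr_ge0// ltW// (lt_le_trans ltr01).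
(* Entries of an admissible [b1] lie in [-K, K] and are coded by 0, ..., 2 K. Since [K <= C * t + 1]
   and [t >= 1], there are [2 * K + 1 <= (2 * C + 3) * t] values per entry. *)
pose K := (Num.truncn (C * t)).+1.
have /andP[KCt' /ltW KCt] := truncn_itv Ct0.
rewrite -/K in KCt; rewrite -(lerD2r 1) natr1 -/K in KCt'.
pose I := 'cV['I_(2 * K).+1]_(1 + p.+1).
pose dec (v : I) : 'cV[int]_(1 + p.+1) := map_mx (fun l : 'I_(2 * K).+1 => (l%:Z - K%:Z)) v.
pose F (v : I) := rows_near_int (dsubmx (dec v))
  (xi *m int_cV R (usubmx (dec v))) (delta / kappa).
pose P (v : I) := dsubmx (dec v) != 0.
pose B := \big[setU/set0]_(v | P v) F v.
have mF v : measurable (F v) by exact: measurable_rows_near_int.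
have mB : measurable B by apply: bigsetU_measurable.
have dk0 : 0 <= delta / kappa by rewrite divr_ge0// ltW.
exists (~` B); split; first exact: measurableC.
- rewrite setCK; apply: le_trans (measure_bigsetU_le _ _ mF) _.
  apply: (@le_trans _ _ (\sum_(v | P v) ((6 * (delta / kappa)) ^+ m)%:E)%E).
    by apply: lee_sum => v Pv; exact: tuple_prob_rows.
  rewrite sumEFin lee_fin sumr_const -[leLHS]mulr_natl.
  apply: ler_wpM2r; first by rewrite exprn_ge0// mulr_ge0.
  apply: (@le_trans _ _ (#|{: I}|%:R)).
    by rewrite ler_nat; exact: max_card.
  rewrite card_mx card_ord muln1 natrX lerXn2r ?nnegrE ?mulr_ge0//; lra.
- move=> s Bs b1 b2 b1d Nb1; rewrite leNgt; apply/negP => small; apply: Bs.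
  have b1K i : `|b1 i ord0| <= K%:Z.
    rewrite -(ler_int R) -pmulrn; apply: le_trans KCt; rewrite intr_norm.
    apply: (@le_trans _ _ `|int_cV R b1|).
      by have := normM_coord_le (int_cV R b1) i ord0; rewrite mxE.
    by apply: le_trans (N1C _) _; rewrite ler_pM2l.
  pose v : I := \col_i inord (absz (b1 i ord0 + K%:Z)%R).
  have dv : dec v = b1.
    apply/matrixP => i j; rewrite ord1 !mxE; have := b1K i.
    by move: (b1 i ord0) => z zK; rewrite inordK; lia.
  have Pv : P v by rewrite /P dv.
  rewrite /B (bigD1 v)//=; left => i; exists (b2 i ord0).
  rewrite dv addrC.
  apply: (@le_trans _ _ `|extended_matrix xi s *m int_cV R b1 + int_cV R b2|).
    apply: le_trans (normM_coord_le _ i ord0).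
    have -> : int_cV R b1 = col_mx (int_cV R (usubmx b1)) (int_cV R (dsubmx b1)).
      by rewrite /int_cV -map_col_mx vsubmxK.
    rewrite /extended_matrix mul_row_col.
    by rewrite [_ *m _ + _]addrC !mxE addrC.
  by rewrite ler_pdivlMr// mulrC; apply: le_trans (N2k _) (ltW small).
Qed.

(** * The first column *)

Section IntegerBasis.
Variables (R : realType) (m : nat).
Local Notation V := (int * 'cV[int]_m)%type.
Implicit Types (z : 'cV[R]_m) (v : V).

(** For [v] = (q, P) this is P - q z, the projection of Z^(1+m) along (1, z). *)
Definition residual z v : 'cV[R]_m := int_cV R v.2 - v.1%:~R *: z.

Lemma residual_is_zmod_morphism z : zmod_morphism (residual z).
Proof.
move=> u v; rewrite /residual /int_cV /= map_mxB rmorphB scalerBl.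
by rewrite !opprB addrACA [RHS]addrACA; congr (_ + _); rewrite addrC.
Qed.

HB.instance Definition _ z :=
  GRing.isZmodMorphism.Build V 'cV[R]_m (residual z) (residual_is_zmod_morphism z).

Definition center v : 'cV[R]_m := (v.1%:~R)^-1 *: int_cV R v.2.

Lemma residual_center v : v.1 != 0 -> residual (center v) v = 0.
Proof.
by move=> v0; rewrite /residual /center scalerA divff ?intr_eq0// scale1r subrr.
Qed.

Lemma residual_change z z' v :
  residual z' v = residual z v - v.1%:~R *: (z' - z).
Proof. by rewrite /residual scalerBr opprB addrA subrK. Qed.

(** Being 1 + m generators of Z^(1+m), such vectors form a basis. *)
Definition spans (x0 : V) (x : nat -> V) : Prop :=
  forall v, exists (c0 : int) (c : nat -> int), v = x0 *~ c0 + \sum_(i < m) x i *~ c i.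

Definition axis (i : nat) : 'cV[R]_m := \col_l (nat_of_ord l == i)%:R.

(** The relative error 1/(2m) is such that the errors of m vectors together stay below half of the
    dominant term. *)
Definition near_axes (f : nat -> 'cV[R]_m) (alpha : nat -> R) : Prop :=
  forall i, (i < m)%N ->
    0 < alpha i /\ `|f i - alpha i *: axis i| < (2 * m%:R)^-1 * alpha i.

(** Take the index [k] that maximizes |c k| alpha k and read off coordinate [k]: the main term is
    this maximum, and the m errors add up to at most half of it. *)
Lemma near_axes_lower f alpha (c : nat -> R) j : near_axes f alpha -> (j < m)%N ->
  2^-1 * (`|c j| * alpha j) <= `|\sum_(i < m) c i *: f i|.
Proof.
move=> hf jm.
have [k _ kmax] := @arg_maxP _ _ _ (Ordinal jm) predT (fun i : 'I_m => `|c i| * alpha i) isT.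
have m0 : 0 < m%:R :> R by rewrite ltr0n (leq_ltn_trans _ jm).
apply: (@le_trans _ _ (2^-1 * (`|c k| * alpha k))).
  by rewrite ler_pM2l ?invr_gt0//; have := kmax (Ordinal jm) isT.
apply: le_trans (normM_coord_le _ k ord0).
pose M := `|c k| * alpha k.
have -> : (\sum_(i < m) c i *: f i) k ord0 = c k * alpha k +
    \sum_(i < m) (c i *: (f i - alpha i *: axis i)) k ord0.
  rewrite summxE (eq_bigr (fun i : 'I_m => (c i *: (f i - alpha i *: axis i)) k ord0
     + c i * alpha i * (k == i)%:R)); last first.
    by move=> i _; rewrite !mxE (inj_eq val_inj); ring.
  rewrite big_split /= addrC; congr (_ + _).
  rewrite (bigD1 k)//= eqxx mulr1 big1 ?addr0// => i ik.
  by rewrite eq_sym (negbTE ik) mulr0.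
apply: le_trans (lerB_normD _ _).
rewrite normrM (gtr0_norm (hf k (ltn_ord k)).1) -/M.
suff : `|\sum_(i < m) (c i *: (f i - alpha i *: axis i)) k ord0| <= 2^-1 * M by lra.
apply: le_trans (ler_norm_sum _ _ _) _.
apply: (@le_trans _ _ (\sum_(i < m) (2 * m%:R)^-1 * M)); last first.
  rewrite sumr_const card_ord -[leLHS]mulr_natl le_eqVlt; apply/orP; left; apply/eqP.
  by field; rewrite gt_eqF.
apply: ler_sum => i _; have [a0 fa] := hf i (ltn_ord i).
rewrite mxE normrM; apply: (@le_trans _ _ (`|c i| * ((2 * m%:R)^-1 * alpha i))).
  by rewrite ler_wpM2l//; apply: le_trans (ltW fa); exact: normM_coord_le.
rewrite mulrCA ler_pM2l ?invr_gt0 ?mulr_gt0//.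
exact: kmax.
Qed.

End IntegerBasis.

Section Chain.
Variables (R : realType) (m : nat).
Local Notation V := (int * 'cV[int]_m)%type.
Variables (x0 : V) (x : nat -> V).

(* From the basis [x0, x 0, ..., x m.-1] of Z^(1+m) one passes to the basis
   [chain m, - chain 0, ..., - chain m.-1]. *)
Fixpoint chain (S : nat -> nat) (i : nat) : V :=
  if i is j.+1 then chain S j *+ S j + x j else x0.

(** The relation [x i = chain S i.+1 - S i * chain S i] recovers the old generators from the
    chain. *)
Lemma chain_spans S : spans x0 x -> spans (chain S m) (fun i => - chain S i).
Proof.
move=> x_spans.
pose P (v : V) := exists (c0 : int) (c : nat -> int),
  v = chain S m *~ c0 + \sum_(i < m) (- chain S i) *~ c i.
have PD u v : P u -> P v -> P (u + v).
  move=> [c0 [c ->]] [c0' [c' ->]]; exists (c0 + c0'), (fun i => c i + c' i).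
  rewrite mulrzDr addrACA; congr (_ + _); rewrite -big_split; apply: eq_bigr => i _.
  by rewrite mulrzDr.
have PZ u (k : int) : P u -> P (u *~ k).
  move=> [c0 [c ->]]; exists (c0 * k), (fun i => c i * k).
  rewrite mulrzDl -mulrzA; congr (_ + _).
  rewrite mulrz_suml; by apply: eq_bigr => i _; rewrite mulrzA.
have P0 : P 0.
  by exists 0, (fun=> 0); rewrite mulr0z big1 ?addr0// => i _; rewrite mulr0z.
have Pchain i : (i <= m)%N -> P (chain S i).
  rewrite leq_eqVlt => /predU1P[->|im].
    by exists 1, (fun=> 0); rewrite mulr1z big1 ?addr0// => i' _; rewrite mulr0z.
  exists 0, (fun l => - (l == i)%:Z); rewrite mulr0z add0r (bigD1 (Ordinal im))//= eqxx.
  rewrite mulrN1z opprK big1 ?addr0// => l li.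
  by rewrite (negbTE (_ : nat_of_ord l != i)) ?oppr0 ?mulr0z.
have Px i : (i < m)%N -> P (x i).
  move=> im; have -> : x i = chain S i.+1 + chain S i *~ (- (S i)%:Z).
    by rewrite mulrNz -pmulrn /= addrAC subrr add0r.
  by apply: PD; [exact: Pchain|apply/PZ/Pchain/ltnW].
move=> v; have [c0 [c ->]] := x_spans v; apply: (PD); first exact/PZ/(Pchain 0%N).
have : forall i : 'I_m, P (x i *~ c i) by move=> i; apply/PZ/Px.
by move=> h; elim/big_ind : _.
Qed.

Hypothesis x0_gt0 : 0 < x0.1.
Variable S : nat -> nat -> nat.
Hypothesis S_gt0 : forall N i, (0 < S N i)%N.
Hypothesis S_cvg : forall i, ((S N i)%:R : R)^-1 @[N --> \oo] --> (0 : R).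

Let den N i : R := (chain (S N) i).1%:~R.
Let prodS N i : R := \prod_(l < i) (S N l)%:R.

Let prodS_gt0 N i : 0 < prodS N i.
Proof. by apply: prodr_gt0 => l _; rewrite ltr0n. Qed.

Let prodSV_cvg i : (prodS N i.+1)^-1 @[N --> \oo] --> (0 : R).
Proof.
have S1 N l : ((S N l)%:R : R)^-1 <= 1 by rewrite invf_le1 ?ltr0n// ler1n.
apply: (squeeze_cvgr _ (cvg_cst 0) (S_cvg i)); near=> N.
rewrite invr_ge0 ltW//= /prodS big_ord_recr /= invfM ler_piMl ?invr_ge0 ?ler0n//.
rewrite -prodfV; apply: prodr_ile1 => l; by rewrite invr_ge0 ler0n S1.
Unshelve. all: by end_near. Qed.

(** Dividing the recursion by the product of the multipliers, each step adds only [(x i).1] over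
    that product, which tends to 0. *)
Lemma chain_den_cvg i :
  (chain (S N) i).1%:~R / \prod_(l < i) (S N l)%:R @[N --> \oo] --> (x0.1%:~R : R).
Proof.
elim: i => [|i IH].
  under eq_fun do rewrite big_ord0 divr1; exact: cvg_cst.
have -> : (fun N => (chain (S N) i.+1).1%:~R / \prod_(l < i.+1) (S N l)%:R) =
    (fun N => den N i / prodS N i + (x i).1%:~R * (prodS N i.+1)^-1).
  apply/funext => N; rewrite /den /prodS /= rmorphD /= mulrDl; congr (_ + _).
  rewrite big_ord_recr /= (_ : (_ *+ S N i).1 = (chain (S N) i).1 *+ S N i); last first.
    exact: raddfMn.
  rewrite rmorphMn /= -[X in X / _]mulr_natr invfM mulrACA divff ?mulr1//.
  by rewrite pnatr_eq0 -lt0n.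
rewrite -[x in _ --> x]addr0; apply: cvgD => //.
rewrite -[x in _ --> x](mulr0 (x i).1%:~R); apply: cvgM; first exact: cvg_cst.
exact: prodSV_cvg.
Qed.

Lemma chain_den_gt0 i : \forall N \near \oo, (0 < (chain (S N) i).1).
Proof.
have x0R : 0 < (x0.1%:~R : R) by rewrite ltr0z.
near=> N; rewrite -(ltr0z R).
have : 0 < den N i / prodS N i by near: N; exact: (cvgr_gt _ (chain_den_cvg i)).
by rewrite pmulr_lgt0 ?invr_gt0.
Unshelve. all: by end_near. Qed.

Lemma chain_denV_cvg i :
  ((chain (S N) i.+1).1%:~R : R)^-1 @[N --> \oo] --> (0 : R).
Proof.
have x0R : (x0.1%:~R : R) != 0 by rewrite intr_eq0 gt_eqF.
have -> : (fun N => ((chain (S N) i.+1).1%:~R : R)^-1) =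
    (fun N => (den N i.+1 / prodS N i.+1)^-1 * (prodS N i.+1)^-1).
  by apply/funext => N; rewrite invfM invrK mulrAC -mulrA mulVf ?mulr1// gt_eqF.
rewrite -[x in _ --> x](mulr0 (x0.1%:~R : R)^-1).
by apply: cvgM; [exact: (cvgV _ (chain_den_cvg i.+1))|exact: prodSV_cvg].
Qed.

(** Two consecutive centers differ by the residual of [x i] at the earlier center, divided by the
    new denominator; the residual stays bounded and the denominator tends to infinity. *)
Lemma center_chain_cvg i : center R (chain (S N) i) @[N --> \oo] --> center R x0.
Proof.
elim: i => [|i IH]; first exact: (cvg_cst (center R x0)).
have : (fun N => center R (chain (S N) i) + ((chain (S N) i.+1).1%:~R)^-1 *:
    (residual (center R x0) (x i) -
     (x i).1%:~R *: (center R (chain (S N) i) - center R x0))) @ \oo --> center R x0.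
  rewrite -[x in _ --> x]addr0; apply: cvgD => //.
  rewrite -[x in _ --> x](scale0r (residual (center R x0) (x i) -
    (x i).1%:~R *: (center R x0 - center R x0))).
  apply: cvgZ; first exact: chain_denV_cvg.
  apply: cvgB; first exact: cvg_cst.
  apply: cvgZ; first exact: cvg_cst.
  by apply: cvgB => //; exact: cvg_cst.
apply: cvg_trans; apply: near_eq_cvg; near=> N.
have d1 : (chain (S N) i).1 != 0 by rewrite gt_eqF//; near: N; exact: chain_den_gt0.
have d2 : (chain (S N) i.+1).1 != 0 by rewrite gt_eqF//; near: N; exact: chain_den_gt0.
rewrite -residual_change.
have := residual_change (center R (chain (S N) i)) (center R (chain (S N) i.+1))
  (chain (S N) i.+1).
rewrite residual_center// raddfD raddfMn /= residual_center// mul0rn add0r.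
move=> /esym/eqP; rewrite subr_eq0 => /eqP ->.
by rewrite scalerA mulVf ?intr_eq0// scale1r addrC subrK.
Unshelve. all: by end_near. Qed.

Let zm N := center R (chain (S N) m).

(** Downward induction from [i = m], where the residual vanishes. Since S i times [chain i] equals
    [chain i.+1] minus [x i], a vanishing residual at [i.+1] determines the scaled residual at [i],
    and dividing by S i makes it vanish in turn. *)
Lemma residual_chain_cvg i : (i <= m)%N ->
  residual (zm N) (chain (S N) i) @[N --> \oo] --> (0 : 'cV[R]_m) /\
  ((i < m)%N -> (S N i)%:R *: residual (zm N) (chain (S N) i) @[N --> \oo] -->
    - residual (center R x0) (x i)).
Proof.
move=> /subnK; move: (m - i)%N => k; elim: k i => [|k IH] i.
  rewrite add0n => ->; rewrite ltnn; split => //.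
  apply: (@cvg_trans _ (0 @[N --> \oo])); last exact: cvg_cst.
  apply: near_eq_cvg; near=> N; rewrite residual_center// gt_eqF//.
  by near: N; exact: chain_den_gt0.
rewrite addSnnS => ki; have [h0 _] := IH _ ki.
have im : (i < m)%N by rewrite -ki ltn_addl.
have hS : (S N i)%:R *: residual (zm N) (chain (S N) i) @[N --> \oo] -->
    - residual (center R x0) (x i).
  have -> : (fun N => (S N i)%:R *: residual (zm N) (chain (S N) i)) =
      (fun N => residual (zm N) (chain (S N) i.+1) -
        (residual (center R x0) (x i) - (x i).1%:~R *: (zm N - center R x0))).
    apply/funext => N; rewrite -residual_change /= (raddfD (residual (zm N))).
    rewrite (raddfMn (residual (zm N))).
    by rewrite addrK scaler_nat.
  rewrite -[x in _ --> x]add0r; apply: cvgB => //.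
  rewrite -[x in _ --> x]subr0; apply: cvgB; first exact: cvg_cst.
  rewrite -[x in _ --> x](scaler0 _ (x i).1%:~R) -[in x in _ --> x](subrr (center R x0)).
  apply: cvgZ; first exact: cvg_cst.
  by apply: cvgB; [exact: center_chain_cvg|exact: cvg_cst].
split=> //.
have -> : (fun N => residual (zm N) (chain (S N) i)) =
    (fun N => ((S N i)%:R)^-1 *: ((S N i)%:R *: residual (zm N) (chain (S N) i))).
  by apply/funext => N; rewrite scalerA mulVf ?scale1r// pnatr_eq0 -lt0n.
rewrite -[x in _ --> x](scale0r (- residual (center R x0) (x i))).
by apply: cvgZ => //; exact: hS.
Unshelve. all: by end_near. Qed.

End Chain.

(** The equation amounts to r^(1-w) = (b/c) (beta t^m)^w, which determines [r]. From [w * m.+1 >= 1]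
    follows t^(m w) >= t^(1-w), so a small [c] makes [r] at least [L * t]. *)
Lemma exists_tuned_ratio (R : realType) (m : nat) (w c kappa L beta b t : R) :
  0 < w < 1 -> 1 <= w * m.+1%:R -> 0 < c -> 0 < kappa -> 0 < L ->
  c * L `^ (1 - w) <= kappa / 4 -> 2^-1 <= beta -> kappa / 2 <= b -> 1 <= t ->
  exists r, [/\ 0 < r, L * t <= r & (beta * (r * t ^+ m)) `^ w * b / r = c].
Proof.
move=> /andP[w0 w1] wm c0 k0 L0 cL beta2 bk t1.
have t0 : 0 < t := lt_le_trans ltr01 t1.
have beta0 : 0 < beta by apply: lt_le_trans beta2.
have b0 : 0 < b by apply: lt_le_trans bk; rewrite divr_gt0.
have w1' : 0 < 1 - w by rewrite subr_gt0.
have tm0 : 0 < t ^+ m by rewrite exprn_gt0.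
pose X := b / c * (beta * t ^+ m) `^ w.
have X0 : 0 < X by rewrite mulr_gt0 ?divr_gt0// powR_gt0// mulr_gt0.
pose r := X `^ (1 - w)^-1.
have r0 : 0 < r by rewrite powR_gt0.
have rX : r `^ (1 - w) = X by rewrite -powRrM mulVf ?gt_eqF// powRr1// ltW.
exists r; split => //.
- rewrite leNgt; apply/negP => rLt.
  have : r `^ (1 - w) < (L * t) `^ (1 - w).
    by apply: gt0_ltr_powR; rewrite ?in_itv /= ?nnegrE ?mulr_ge0// ltW.
  apply/negP; rewrite -leNgt rX powRM ?(ltW L0) ?(ltW t0)//.
  have LE : L `^ (1 - w) <= kappa / 4 / c by rewrite ler_pdivlMr// mulrC.
  apply: (@le_trans _ _ (kappa / 4 / c * (t ^+ m) `^ w)).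
    apply: ler_pM => //; rewrite ?powR_ge0//.
    rewrite -powR_mulrn ?(ltW t0)// -powRrM; apply: ler_powR => //.
    by move: wm; rewrite -natr1 mulrDr mulr1 [w * _]mulrC; lra.
  rewrite /X powRM ?(ltW beta0) ?(ltW tm0)// mulrA; apply: ler_wpM2r; first exact: powR_ge0.
  (* Together with [b >= kappa / 2] this gives the factor [kappa / 4] in the smallness condition on
     [c]. *)
  have betaw : 2^-1 <= beta `^ w.
    apply: (@le_trans _ _ (2^-1 `^ w)).
      by apply: ger1_powR; [rewrite invr_gt0 ltr0n invf_le1 ?ler1n|exact: ltW].
    by apply: ge0_ler_powR => //; rewrite ?nnegrE ?(ltW w0) ?(ltW beta0).
  rewrite [leRHS]mulrAC ler_pM2r ?invr_gt0//.
  by apply: (@le_trans _ _ (kappa / 2 * 2^-1)); [lra|apply: ler_pM => //; lra].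
- have -> : beta * (r * t ^+ m) = (beta * t ^+ m) * r by ring.
  rewrite powRM ?(ltW r0)// ?mulr_ge0 ?(ltW beta0) ?(ltW tm0)//.
  have rw : r `^ w = r / X.
    apply: (canRL (mulfK _)); first by rewrite gt_eqF.
    rewrite -rX -powRD; last by rewrite (gt_eqF r0) implybT.
    by rewrite addrC subrK powRr1// ltW.
  rewrite rw /X.
  have : (beta * t ^+ m) `^ w != 0 by rewrite gt_eqF// powR_gt0// mulr_gt0.
  by move: (_ `^ _) => y y0; field; rewrite y0 !gt_eqF.
Qed.

Lemma powR_cvg1 (R : realType) (w : R) (u : R^nat) :
  u @ \oo --> (1 : R) -> u N `^ w @[N --> \oo] --> (1 : R).
Proof.
move=> u1; rewrite -[x in _ --> x](_ : 1 `^ w = 1); last by rewrite powR1.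
apply: (@cvg_comp _ _ _ u (fun a => a `^ w)); first exact: u1.
have : derivable (fun a : R => a `^ w) 1 1.
  by apply: derivable_powR; rewrite in_itv /= ltr01.
by move=> /derivable1_diffP /differentiable_continuous.
Qed.

(** * One step of the continued fraction *)

Section GoodBasis.
Variables (R : realType) (m' : nat).
Local Notation m := m'.+1.
Local Notation V := (int * 'cV[int]_m)%type.

(* The last condition is about the covolume: the projection of Z^(1+m) along [x0]
   is a lattice of covolume [1 / x0.1]. *)
Definition good_basis (x0 : V) (x : nat -> V) : Prop :=
  [/\ 0 < x0.1, spans x0 x & exists alpha,
    near_axes (fun i => residual (center R x0) (x i)) alpha /\
    2^-1 < x0.1%:~R * \prod_(i < m) alpha i < 2].

Variables (N2 : 'cV[R]_m -> R) (w c kappa K : R).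
Hypothesis N2_norm : is_norm N2.
Hypothesis w01 : 0 < w < 1.
Hypothesis wm : 1 <= w * m%:R.
Hypothesis kappa_gt0 : 0 < kappa.
Hypothesis K_gt0 : 0 < K.
Hypothesis N2K : forall x, N2 x <= K * `|x|.
Hypothesis N2kappa : forall x, kappa * `|x| <= N2 x.
Hypothesis c_gt0 : 0 < c.
Hypothesis c_small : c * (8 * K / kappa) `^ (1 - w) <= kappa / 4.

(** The new head is the end of a chain with large multipliers, and the other vectors are the negated
    earlier links, the first of which is minus [x0]. Projected along the new head, vector i is close
    to [f i] divided by its multiplier, so directions near the axes persist. One multiplier is at
    least about [L] times longer in scale than the others, which makes the projection of [x0] the
    shortest; its scale [r] is tuned so that its N2-norm is close to c times the power -w of the new
    denominator. *)
Lemma good_basis_step x0 x delta : good_basis x0 x -> 0 < delta ->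
  exists x0' x', [/\ good_basis x0' x',
    `|center R x0' - center R x0| <= delta,
    x0.1%:~R <= delta * x0'.1%:~R,
    `|x0'.1%:~R `^ w * N2 (residual (center R x0') x0) - c| <= delta &
    forall v : V, 0 < v.1 < x0'.1 ->
      c - delta <= x0'.1%:~R `^ w * N2 (residual (center R x0') v)].
Proof.
move=> [q0 x_spans [alpha0 [near0 beta0]]] delta0.
pose alpha i := if (i < m)%N then alpha0 i else 1.
have alphaE (i : 'I_m) : alpha i = alpha0 i by rewrite /alpha ltn_ord.
pose f i := residual (center R x0) (x i).
have near_f : near_axes f alpha.
  by move=> i im; rewrite /alpha im; exact: near0.
have alpha_gt0 i : 0 < alpha i.
  by rewrite /alpha; case: ifP => // im; have [] := near0 i im.
pose q : R := x0.1%:~R; have q_gt0 : 0 < q by rewrite ltr0z.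
pose A := \prod_(i < m) alpha i.
have A_gt0 : 0 < A by apply: prodr_gt0.
have {beta0} beta_itv : 2^-1 < q * A < 2.
  by rewrite /A (eq_bigr (fun i : 'I_m => alpha0 i)).
have m_gt0 : 0 < (m%:R : R) by rewrite ltr0n.
have eta1 : (2 * m%:R)^-1 <= 2^-1 :> R.
  by rewrite invfM ler_piMr ?invr_ge0// invf_le1// ler1n.
have axis_norm i : (i < m)%N -> `|axis R m i| = 1.
  move=> im; apply/eqP; rewrite eq_le; apply/andP; split.
    by apply: normM_le => // l k; rewrite mxE normr_nat lern1 leq_b1.
  by have := normM_coord_le (axis R m i) (Ordinal im) ord0; rewrite mxE eqxx normr1.
have near_bounds i (g : nat -> 'cV[R]_m) (a : nat -> R) : near_axes g a -> (i < m)%N ->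
    2^-1 * a i <= `|g i| <= 2 * a i.
  move=> ga im; have [a0 gi] := ga i im.
  have n1 : `|a i *: axis R m i| = a i by rewrite normrZ axis_norm// mulr1 gtr0_norm.
  have h1 := ler_normD (g i - a i *: axis R m i) (a i *: axis R m i).
  have h2 := ler_normD (a i *: axis R m i - g i) (g i).
  rewrite subrK n1 in h1; rewrite subrK n1 distrC in h2.
  have h3 : (2 * m%:R)^-1 * a i <= 2^-1 * a i by rewrite ler_pM2r.
  have {gi h3} gi := lt_le_trans gi h3.
  by apply/andP; split; lra.
have f0_bounds := near_bounds 0%N _ _ near_f isT.
(* To first order the projection of [x0] has N2-norm [b / r], and the new denominator is
   [q * A * (r * t ^+ m')]; these are the data of [exists_tuned_ratio]. *)
pose b := N2 (f 0%N) / alpha 0%N.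
have b_ge : kappa / 2 <= b.
  rewrite ler_pdivlMr//; apply: le_trans (N2kappa _); rewrite -mulrA ler_pM2l//.
  by case/andP: f0_bounds.
pose L := 8 * K / kappa; have L_gt0 : 0 < L by rewrite divr_gt0// mulr_gt0.
pose t (N : nat) : R := N.+1%:R.
have t_ge1 N : 1 <= t N by rewrite ler1n.
have t_gt0 N : 0 < t N by rewrite ltr0n.
have /choice[r r_spec] : forall N, exists r : R,
    [/\ 0 < r, L * t N <= r & ((q * A) * (r * t N ^+ m')) `^ w * b / r = c].
  move=> N; apply: (exists_tuned_ratio (kappa := kappa)) => //.
  by case/andP: beta_itv => /ltW.
have r_gt0 N : 0 < r N by case: (r_spec N).
(* The new residuals are close to [axis i / rho N i]; [r N] tunes the first one. *)
pose rho N i := if i is 0%N then r N else t N.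
have rho_gt0 N i : 0 < rho N i by case: i => [|i] /=; [exact: r_gt0|exact: t_gt0].
have tV_cvg : (t N)^-1 @[N --> \oo] --> (0 : R) by exact: cvg_harmonic.
have rhoV_cvg i : (rho N i)^-1 @[N --> \oo] --> (0 : R).
  case: i => [|i]; last exact: tV_cvg.
  have LtV : L^-1 * (t N)^-1 @[N --> \oo] --> (0 : R).
    by rewrite -[x in _ --> x](mulr0 L^-1); apply: cvgM => //; exact: cvg_cst.
  apply: (squeeze_cvgr _ (cvg_cst 0) LtV).
  apply: nearW => N.
  rewrite invr_ge0 ltW//= -invfM lef_pV2 ?posrE ?(mulr_gt0 L_gt0 (t_gt0 N)) ?r_gt0//.
  by case: (r_spec N).
pose S N i := (Num.truncn (rho N i * alpha i)).+1.
have S_gt0 : forall N i, (0 < S N i)%N by [].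
have S_itv : forall N i, rho N i * alpha i <= (S N i)%:R <= rho N i * alpha i + 1.
  move=> N i.
  have /andP[h1 h2] := truncn_itv (ltW (mulr_gt0 (rho_gt0 N i) (alpha_gt0 i))).
  by rewrite (ltW h2) /= -natr1 lerD2r.
have SVrho_cvg i : (S N i)%:R / rho N i @[N --> \oo] --> alpha i.
  have up : alpha i + (rho N i)^-1 @[N --> \oo] --> alpha i.
    by rewrite -[x in _ --> x]addr0; apply: cvgD => //; exact: cvg_cst.
  apply: (squeeze_cvgr _ (cvg_cst (alpha i)) up).
  apply: nearW => N.
  have /andP[h1 h2] := S_itv N i.
  rewrite ler_pdivlMr// mulrC h1 /= ler_pdivrMr// mulrDl mulVf ?gt_eqF//.
  by rewrite mulrC.
have SV_cvg i : ((S N i)%:R : R)^-1 @[N --> \oo] --> (0 : R).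
  have -> : (fun N => ((S N i)%:R : R)^-1) =
      (fun N => ((S N i)%:R / rho N i)^-1 * (rho N i)^-1).
    by apply/funext => N; rewrite invfM invrK mulrAC -mulrA mulVf ?mulr1// gt_eqF.
  rewrite -[x in _ --> x](mulr0 (alpha i)^-1); apply: cvgM => //.
  by apply: cvgV; rewrite ?gt_eqF.
pose y N i := chain x0 x (S N) i.
pose z N := center R (y N m).
pose h N i : 'cV[R]_m := residual (z N) (- y N i).
have hE N i : h N i = - residual (z N) (y N i) by rewrite /h raddfN.
have Sh_cvg i : (i < m)%N -> (S N i)%:R *: h N i @[N --> \oo] --> f i.
  move=> im; under eq_fun do rewrite hE scalerN.
  have [_ /(_ im) H] := residual_chain_cvg x q0 S_gt0 SV_cvg (ltnW im).
  by rewrite -[f i]opprK; apply: cvgN.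
have z_cvg : z N @[N --> \oo] --> center R x0.
  exact: (center_chain_cvg x q0 S_gt0 SV_cvg m).
pose Q N := (y N m).1%:~R / \prod_(l < m) (S N l)%:R : R.
have Q_cvg : Q N @[N --> \oo] --> q by exact: chain_den_cvg.
have ratio_cvg l : (S N l)%:R / (rho N l * alpha l) @[N --> \oo] --> (1 : R).
  have -> : (fun N => (S N l)%:R / (rho N l * alpha l)) =
      (fun N => (S N l)%:R / rho N l / alpha l).
    by apply/funext => N; rewrite invfM mulrA.
  rewrite -[x in _ --> x](divff (lt0r_neq0 (alpha_gt0 l))).
  by apply: cvgM => //; exact: cvg_cst.
(* The ratio of the true denominator to its model [q * A * (r N * t N ^+ m')]. *)
pose u N := Q N / q * \prod_(l < m) ((S N l)%:R / (rho N l * alpha l)).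
have u_cvg : u N @[N --> \oo] --> (1 : R).
  rewrite -[x in _ --> x]mulr1; apply: cvgM.
    rewrite -[x in _ --> x](divff (lt0r_neq0 q_gt0)).
    by apply: cvgM => //; exact: cvg_cst.
  have : forall k, \prod_(l < k) ((S N l)%:R / (rho N l * alpha l)) @[N --> \oo] --> (1 : R).
    elim=> [|k IH]; first by under eq_fun do rewrite big_ord0; exact: cvg_cst.
    have -> : (fun N => \prod_(l < k.+1) ((S N l)%:R / (rho N l * alpha l))) =
        (fun N => \prod_(l < k) ((S N l)%:R / (rho N l * alpha l)) *
          ((S N k)%:R / (rho N k * alpha k))).
      by apply/funext => N; rewrite big_ord_recr.
    by rewrite -[x in _ --> x]mulr1; apply: cvgM.
  exact.
have prodS_gt0 N : 0 < \prod_(l < m) (S N l)%:R :> R.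
  by apply: prodr_gt0 => l _; rewrite ltr0n.
have denE N : (y N m).1%:~R = q * A * (r N * t N ^+ m') * u N.
  rewrite -[LHS](divfK (lt0r_neq0 (prodS_gt0 N))) -/(Q N) /u prodf_div.
  have -> : \prod_(l < m) (rho N l * alpha l) = r N * t N ^+ m' * A.
    rewrite big_split /= -/A; congr (_ * _).
    by rewrite big_ord_recl /= prodr_const card_ord.
  have := prodS_gt0 N; move: (\prod_(l < m) (S N l)%:R) (Q N) => P Q' P0.
  have tm0 : t N ^+ m' != 0 by rewrite gt_eqF// exprn_gt0.
  by field; rewrite tm0 !gt_eqF.
have N2f0 : 0 < N2 (f 0%N).
  apply: lt_le_trans (N2kappa _); rewrite mulr_gt0//.
  by apply: lt_le_trans (proj1 (andP f0_bounds)); rewrite mulr_gt0// invr_gt0.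
pose T N := (y N m).1%:~R `^ w * N2 (residual (z N) x0).
have hN2 N i : N2 (h N i) = N2 ((S N i)%:R *: h N i) / (S N i)%:R.
  by rewrite is_normZ// ger0_norm// mulrAC divff ?mul1r// pnatr_eq0.
have N2h_cvg : N2 ((S N 0%N)%:R *: h N 0%N) @[N --> \oo] --> N2 (f 0%N).
  apply/cvgrPdist_le => e e0.
  have eK : 0 < e / K by rewrite divr_gt0.
  move/cvgrPdist_le/(_ _ eK): (Sh_cvg 0%N isT); apply: filterS => N hN.
  apply: le_trans (is_norm_dist _ _ _) _ => //; apply: le_trans (N2K _) _.
  by rewrite mulrC -ler_pdivlMr.
have u_gt0 : \forall N \near \oo, 0 < u N by exact: (cvgr_gt _ u_cvg).
(* The model value is exactly [c] by the choice of [r]; what remains is a product of corrections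
   tending to 1. *)
have TE : \forall N \near \oo, T N = c * (u N `^ w *
    ((S N 0%N)%:R / (rho N 0%N * alpha 0%N))^-1 * (N2 ((S N 0%N)%:R *: h N 0%N) / N2 (f 0%N))).
  apply: filterS u_gt0 => N u0.
  have -> : T N = (y N m).1%:~R `^ w * N2 (h N 0%N) by rewrite hE is_normN.
  have [_ _ <-] := r_spec N.
  have X0 : 0 < q * A * (r N * t N ^+ m') by rewrite !mulr_gt0// exprn_gt0.
  rewrite denE powRM ?(ltW X0) ?(ltW u0)// hN2 /b /=.
  by field; rewrite ?pnatr_eq0 /= !gt_eqF ?alpha_gt0.
have T_cvg : T N @[N --> \oo] --> c.
  have : c * (u N `^ w *
    ((S N 0%N)%:R / (rho N 0%N * alpha 0%N))^-1 * (N2 ((S N 0%N)%:R *: h N 0%N) / N2 (f 0%N)))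
    @[N --> \oo] --> c * (1 * 1^-1 * (N2 (f 0%N) / N2 (f 0%N))).
    apply: cvgM; first exact: cvg_cst.
    apply: cvgM; last by apply: cvgM => //; exact: cvg_cst.
    apply: cvgM; first exact: powR_cvg1.
    by apply: cvgV => //; rewrite oner_eq0.
  rewrite invr1 divff ?gt_eqF// !mulr1; apply: cvg_trans; apply: near_eq_cvg.
  by apply: filterS TE => N ->.
have near_h : \forall N \near \oo, forall i : 'I_m,
    `|(S N i)%:R *: h N i - alpha i *: axis R m i| < (2 * m%:R)^-1 * alpha i.
  apply: filter_forall => i; have [_ fi] := near_f i (ltn_ord i).
  rewrite -subr_gt0 in fi.
  move/cvgrPdist_lt/(_ _ fi): (Sh_cvg i (ltn_ord i)); apply: filterS => N.
  rewrite distrC => lt1.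
  have := ler_normD ((S N i)%:R *: h N i - f i) (f i - alpha i *: axis R m i).
  by rewrite addrA subrK => /le_lt_trans; apply; rewrite -ltrBrDr.
have near_t : \forall N \near \oo, forall i : 'I_m, 1 <= t N * alpha i.
  apply: filter_forall => i.
  have tV := cvgr_lt _ tV_cvg _ (alpha_gt0 i); apply: filterS (tV _) => N /ltW.
  by rewrite -ler_pdivrMl// mulr1.
have QA_cvg : Q N * A @[N --> \oo] --> q * A by apply: cvgM => //; exact: cvg_cst.
have den_gt0 := chain_den_gt0 x q0 S_gt0 SV_cvg m.
have denV_cvg : ((y N m).1%:~R : R)^-1 @[N --> \oo] --> (0 : R).
  exact: (chain_denV_cvg x q0 S_gt0 SV_cvg m').
near \oo => N.
have d0 : 0 < (y N m).1 by near: N.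
have dR0 : 0 < ((y N m).1%:~R : R) by rewrite ltr0z.
have hN : forall i : 'I_m,
    `|(S N i)%:R *: h N i - alpha i *: axis R m i| < (2 * m%:R)^-1 * alpha i.
  by near: N.
have S0 i : 0 < ((S N i)%:R : R) by rewrite ltr0n.
pose alpha' i := alpha i / (S N i)%:R.
have near_h' : near_axes (h N) alpha'.
  move=> i im; split; first by rewrite divr_gt0.
  have := hN (Ordinal im); rewrite /= mulrA ltr_pdivlMr// => /le_lt_trans; apply.
  rewrite -[X in _ * X](gtr0_norm (S0 i)) mulrC -normrZ scalerBr scalerA mulrCA.
  by rewrite divff ?mulr1// gt_eqF.
exists (y N m), (fun i => - y N i); split.
- split => //; first exact: chain_spans.
  exists alpha'; split => //.
  (* The covolume quantity of the new basis tends to the old one, [q * A], which lies in an open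
     interval; hence the bounds persist. *)
  have -> : (y N m).1%:~R * \prod_(i < m) alpha' i = Q N * A.
    by rewrite prodf_div -/A mulrCA mulrC -mulrA [_^-1 * _]mulrC.
  apply/andP; split.
    by near: N; apply: (cvgr_gt _ QA_cvg); case/andP: beta_itv.
  by near: N; apply: (cvgr_lt _ QA_cvg); case/andP: beta_itv.
- rewrite distrC; near: N; move/cvgrPdist_le: z_cvg; exact.
- have : (y N m).1%:~R^-1 < delta / q.
    by near: N; apply: (cvgr_lt _ denV_cvg); rewrite divr_gt0.
  by rewrite -/q ltr_pdivlMr// ltr_pdivrMl// mulrC => /ltW.
- rewrite distrC; near: N; move/cvgrPdist_le: T_cvg; exact.
move=> v /andP[v0 vd].
have TN : c - delta <= T N.
  have : `|c - T N| <= delta by near: N; move/cvgrPdist_le: T_cvg; exact.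
  by rewrite ler_norml => /andP[]; lra.
apply: le_trans TN _; rewrite /T ler_pM2l ?powR_gt0//.
have -> : N2 (residual (z N) x0) = N2 (h N 0%N) by rewrite hE is_normN.
have [k0 [k vE]] := chain_spans (S N) x_spans v.
have zc : residual (z N) (chain x0 x (S N) m) = 0.
  by apply: residual_center; rewrite gt_eqF.
have rE : residual (z N) v = \sum_(i < m) (k i)%:~R *: h N i.
  rewrite vE (raddfD (residual (z N))) (raddfMz (residual (z N))) [X in X *~ _]zc mul0rz add0r.
  by rewrite raddf_sum; apply: eq_bigr => i _; rewrite (raddfMz (residual (z N))) scaler_int.
(* A nonzero coefficient off the first vector forces N2-norm at least kappa/(4t) = 2K/(Lt), while
   the first vector has N2-norm at most 2K/r. The constant 8 in [L] comes from this comparison. *)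
have [/existsP[i /andP[i0 ki]]|/existsPn no_i] :=
    boolP [exists i : 'I_m, (nat_of_ord i != 0%N) && (k i != 0)].
- apply: le_trans (N2kappa _); rewrite rE.
  have := near_axes_lower (fun i => (k i)%:~R) near_h' (ltn_ord i).
  have k1 : 1 <= `|(k i)%:~R : R|.
    by rewrite -intr_norm -[1]/(1%:~R) ler_int -gtz0_ge1 normr_gt0.
  move=> low; apply: (@le_trans _ _ (kappa * (2^-1 * alpha' i))); last first.
    rewrite ler_pM2l//; apply: le_trans low; rewrite ler_pM2l ?invr_gt0//.
    by rewrite ler_peMl// ltW// divr_gt0.
  have nt : 1 <= t N * alpha i by move: (i); near: N.
  have a'i : (2 * t N)^-1 <= alpha' i.
    rewrite ler_pdivlMr// mulrC ler_pdivrMr ?mulr_gt0//.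
    have /andP[_] := S_itv N i; case: (nat_of_ord i) i0 nt => // j _ nt /= Sle.
    by apply: le_trans Sle _; lra.
  have a'0 : alpha' 0%N <= (r N)^-1.
    rewrite ler_pdivrMr// mulrC ler_pdivlMr// mulrC.
    by have /andP[] := S_itv N 0%N.
  have /andP[_ h0] := near_bounds 0%N _ _ near_h' isT.
  have Lr : L * t N <= r N by case: (r_spec N).
  apply: le_trans (N2K _) _; apply: (@le_trans _ _ (K * (2 * (r N)^-1))).
    by rewrite ler_pM2l//; apply: le_trans h0 _; rewrite ler_pM2l.
  apply: (@le_trans _ _ (kappa * (2^-1 * (2 * t N)^-1))); last first.
    by rewrite ler_pM2l// ler_pM2l ?invr_gt0.
  have -> : kappa * (2^-1 * (2 * t N)^-1) = K * (2 * (L * t N)^-1).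
    by rewrite /L; field; rewrite !gt_eqF.
  by rewrite ler_pM2l// ler_pM2l// lef_pV2 ?posrE ?(mulr_gt0 L_gt0 (t_gt0 N)).
- have k0i i : (0 < i < m)%N -> k i = 0.
    move=> /andP[i0 im]; have := no_i (Ordinal im); rewrite negb_and /= -lt0n i0 /=.
    by move/negPn/eqP.
  have -> : residual (z N) v = (k 0%N)%:~R *: h N 0%N.
    rewrite rE big_ord_recl big1 ?addr0// => l _.
    by rewrite k0i ?scale0r//= ltnS ltn_ord.
  rewrite is_normZ// ler_peMl ?is_norm_ge0// -intr_norm -[1]/(1%:~R) ler_int -gtz0_ge1.
  (* If all these coefficients vanish, [v] is a multiple of the new head, whose denominator cannot
     lie strictly between 0 and that of the head. *)
  rewrite normr_gt0; apply: contraTneq v0 => k00.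
  have vE' : v.1 = (y N m).1 * k0.
    rewrite vE big1 ?addr0 => [|[[|l] lm] _]; rewrite ?k00 ?(k0i l.+1)// ?mulr0z//.
    by rewrite -mulrzz; exact: (raddfMz fst).
  move: vd; rewrite vE' -[X in _ < X]mulr1 ltr_pM2l// -leNgt pmulr_rle0//; lia.
Unshelve. all: by end_near. Qed.
End GoodBasis.

(** * The limit of the rational points *)

Lemma nested_intervals (R : realType) (u e : nat -> R) :
  (forall k, 0 <= e k) -> (forall k, `|u k.+1 - u k| <= e k - e k.+1) ->
  exists x, forall k, `|x - u k| <= e k.
Proof.
move=> e0 ue; pose l k := u k - e k; pose r k := u k + e k.
have lS k : l k <= l k.+1 by have := ue k; rewrite ler_norml /l => /andP[]; lra.
have rS k : r k.+1 <= r k by have := ue k; rewrite ler_norml /r => /andP[]; lra.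
have l_le := homo_leq (@lexx _ R) le_trans lS.
have r_le : forall i j, (i <= j)%N -> r j <= r i.
  apply: (@homo_leq _ r (fun x y => y <= x)) => // y x z yx zy.
  exact: le_trans zy yx.
have lr i j : l i <= r j.
  have [ij|/ltnW ji] := leqP i j.
    by apply: le_trans (l_le _ _ ij) _; have := e0 j; rewrite /l /r; lra.
  by apply: le_trans (r_le _ _ ji); have := e0 i; rewrite /l /r; lra.
have ub : has_ubound (range l) by exists (r 0%N) => _ [k _ <-].
exists (sup (range l)) => k; rewrite ler_norml.
have h1 : l k <= sup (range l) by apply: ub_le_sup => //; exists k.
have h2 : sup (range l) <= r k.
  by apply: ge_sup; [exists (l 0%N), 0%N|move=> _ [j _ <-]].
by move: h1 h2; rewrite /l /r => h1 h2; apply/andP; split; lra.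
Qed.

Lemma good_basis_init (R : realType) (m' : nat) :
  exists (x0 : int * 'cV[int]_m'.+1) x, good_basis R x0 x.
Proof.
exists (1, 0), (fun i => (0, \col_l (nat_of_ord l == i)%:R)).
have c0 : center R (1, 0 : 'cV[int]_m'.+1) = 0.
  by rewrite /center /int_cV /= map_mx0 scaler0.
split => //.
- move=> [a b]; exists a, (fun i => b (inord i) ord0).
  rewrite [RHS]surjective_pairing; congr (_, _).
    rewrite (raddfD fst) (raddfMz fst) raddf_sum /= big1 ?addr0.
      by rewrite intz.
    by move=> i _; rewrite (raddfMz fst) mul0rz.
  rewrite (raddfD snd) (raddfMz snd) mul0rz add0r raddf_sum.
  apply/matrixP => i j; rewrite ord1 summxE (bigD1 i)//= big1 ?addr0.
    by rewrite (raddfMz snd) -scaler_int !mxE eqxx inord_val mulr1 intz.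
  move=> l li; rewrite (raddfMz snd) -scaler_int !mxE (inj_eq val_inj).
  by rewrite eq_sym (negbTE li) mulr0.
- exists (fun=> 1); split.
    move=> i im; split => //; rewrite scale1r mulr1.
    rewrite (_ : residual _ _ - _ = 0) ?normr0 ?invr_gt0 ?mulr_gt0 ?ltr0n//.
    rewrite c0 /residual scaler0 subr0; apply/matrixP => l j.
    by rewrite !mxE natz subrr.
  by rewrite big1// mulr1 invf_lt1 ?ltr1n.
Qed.

Section TunedVector.
Variables (R : realType) (m' : nat).
Local Notation m := m'.+1.
Local Notation V := (int * 'cV[int]_m)%type.
Variables (N2 : 'cV[R]_m -> R) (w c kappa K : R).
Hypothesis N2_norm : is_norm N2.
Hypothesis w01 : 0 < w < 1.
Hypothesis wm : 1 <= w * m%:R.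
Hypothesis kappa_gt0 : 0 < kappa.
Hypothesis K_gt0 : 0 < K.
Hypothesis N2K : forall x, N2 x <= K * `|x|.
Hypothesis N2kappa : forall x, kappa * `|x| <= N2 x.
Hypothesis c_gt0 : 0 < c.
Hypothesis c_small : c * (8 * K / kappa) `^ (1 - w) <= kappa / 4.

(** Iterate [good_basis_step] and let [xi] be the limit of the centers. Half of the error 1/(k+1) is
    spent on the step itself, the other half on passing from center k+1 to [xi]. *)
Lemma exists_tuned_vector : exists (xi : 'cV[R]_m) (X : nat -> V), forall k,
  [/\ 0 < (X k).1, (k.+1%:Z * (X k).1 <= (X k.+1).1),
    (X k.+1).1%:~R `^ w * N2 (residual xi (X k)) <= c + k.+1%:R^-1 &
    forall v : V, 0 < v.1 < (X k.+1).1 ->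
      c - k.+1%:R^-1 <= (X k.+1).1%:~R `^ w * N2 (residual xi v)].
Proof.
pose M := K + 1; have M_gt0 : 0 < M by rewrite addr_gt0.
(* For denominators at most q, moving the center by D changes the scaled N2-norm by at most K q^2 D,
   whence the square. The power of 2 makes D at least halve at each step, so that the distances
   between centers telescope. *)
pose D (k : nat) (x0 : V) : R := (2 ^+ k.+1 * M * (x0.1%:~R ^+ 2))^-1.
(* [choice] requires a total relation: goodness is a premise, and a pair that is not good is sent to
   itself. *)
have stepP (ks : nat * (V * (nat -> V))) : exists s' : V * (nat -> V),
    let: (k, s) := ks in good_basis R s.1 s.2 ->
    [/\ good_basis R s'.1 s'.2,
    `|center R s'.1 - center R s.1| <= D k s.1 / 2,
    s.1.1%:~R <= D k s.1 / 2 * s'.1.1%:~R,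
    `|s'.1.1%:~R `^ w * N2 (residual (center R s'.1) s.1) - c| <= D k s.1 / 2 &
    forall v : V, 0 < v.1 < s'.1.1 ->
      c - D k s.1 / 2 <= s'.1.1%:~R `^ w * N2 (residual (center R s'.1) v)].
  case: ks => k s; have [gs|ngs] := pselect (good_basis R s.1 s.2); last by exists s.
  have D0 : 0 < D k s.1 / 2.
    by case: gs => s0 _ _; rewrite divr_gt0// invr_gt0 !mulr_gt0 ?exprn_gt0// ltr0z.
  have [x0' [x' h]] := good_basis_step N2_norm w01 wm kappa_gt0 K_gt0 N2K N2kappa
    c_gt0 c_small gs D0.
  by exists (x0', x').
have [F FP] := choice stepP.
have [b0 [b b_good]] := good_basis_init R m'.
pose st := fix st k := if k is j.+1 then F (j, st j) else (b0, b).
have st_good k : good_basis R (st k).1 (st k).2.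
  by elim: k => [|k IH] //=; have [] := FP (k, st k) IH.
pose X k := (st k).1; pose z k := center R (X k).
have stP k := FP (k, st k) (st_good k).
have X_gt0 k : 0 < (X k).1 by case: (st_good k).
have XR k : 1 <= (X k).1%:~R :> R by rewrite -[1]/(1%:~R) ler_int -gtz0_ge1.
have den_gt0 k : 0 < 2 ^+ k.+1 * M * (X k).1%:~R ^+ 2.
  by rewrite !mulr_gt0 ?exprn_gt0// ltr0z.
have D_gt0 k : 0 < D k (X k) by rewrite invr_gt0.
have D_le k : D k (X k) <= k.+1%:R^-1.
  rewrite lef_pV2 ?posrE ?ltr0n//.
  have h1 : k.+1%:R <= 2 ^+ k.+1 :> R by rewrite -natrX ler_nat ltnW// ltn_expl.
  have h2 : 1 <= (X k).1%:~R ^+ 2 :> R by rewrite exprn_ege1.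
  have h3 : 1 <= M by rewrite /M lerDr ltW.
  rewrite -mulrA -[leLHS]mulr1; apply: ler_pM => //; exact: mulr_ege1.
have X_growth k : k.+1%:Z * (X k).1 <= (X k.+1).1.
  case: (stP k) => _ _ h _ _; rewrite -(ler_int R) intrM -pmulrn.
  rewrite -ler_pdivlMl ?ltr0n//; apply: le_trans h _.
  rewrite ler_wpM2r ?ler0z ?(ltW (X_gt0 k.+1))//.
  rewrite -/(X k); have := D_le k; have := D_gt0 k.
  by move: (D k (X k)) (_^-1) => a a' ? ?; lra.
have X_mono k : (X k).1 <= (X k.+1).1.
  by apply: le_trans (X_growth k); rewrite ler_peMl ?(ltW (X_gt0 k)).
have DS k : D k.+1 (X k.+1) <= D k (X k) / 2.
  rewrite -invfM lef_pV2 ?posrE ?(den_gt0 k.+1) ?(mulr_gt0 (den_gt0 k))//.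
  rewrite mulrC [2 ^+ k.+2]exprS -!mulrA ler_pM2l// ler_pM2l ?exprn_gt0//.
  rewrite ler_pM2l//; apply: lerXn2r;
    rewrite ?nnegrE ?ler0z ?(ltW (X_gt0 k)) ?(ltW (X_gt0 k.+1))//.
  by rewrite ler_int.
have zD k : `|z k.+1 - z k| <= D k (X k) - D k.+1 (X k.+1).
  by have [_ h _ _ _] := stP k; apply: le_trans h _; have := DS k; rewrite -/(X k); lra.
have /choice[xi0 xi0P] : forall i : 'I_m, exists x, forall k, `|x - z k i ord0| <= D k (X k).
  move=> i; apply: nested_intervals => k; first exact: ltW.
  apply: le_trans (zD k); have := normM_coord_le (z k.+1 - z k) i ord0.
  by rewrite !mxE.
pose xi := \col_i xi0 i.
have xiP k : `|xi - z k| <= D k (X k).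
  apply: normM_le => [|i j]; first exact: ltW.
  rewrite ord1 (_ : (xi - z k) i ord0 = xi0 i - z k i ord0); first exact: xi0P.
  by rewrite !mxE.
have perturb k (v : V) : 0 < v.1 <= (X k.+1).1 ->
    (X k.+1).1%:~R `^ w * `|N2 (residual xi v) - N2 (residual (z k.+1) v)| <=
      k.+1%:R^-1 / 2.
  move=> /andP[v0 vX]; set Q : R := (X k.+1).1%:~R.
  have Q1 : 1 <= Q by exact: XR.
  have Q0 : 0 < Q by exact: lt_le_trans Q1.
  have diff : `|N2 (residual xi v) - N2 (residual (z k.+1) v)| <= K * (Q * D k.+1 (X k.+1)).
    apply: le_trans (is_norm_dist _ _ _) _ => //; apply: le_trans (N2K _) _.
    rewrite ler_pM2l// (residual_change (z k.+1) xi) addrAC subrr add0r normrN normrZ.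
    rewrite ger0_norm ?ler0z ?(ltW v0)//; apply: ler_pM => //.
      by rewrite ler0z ltW.
    by rewrite ler_int.
  have Qw : Q `^ w <= Q.
    by apply: ler1_powR => //; apply: ltW; case/andP: w01.
  apply: (@le_trans _ _ (Q * (K * (Q * D k.+1 (X k.+1))))).
    by apply: ler_pM; rewrite ?powR_ge0.
  have -> : Q * (K * (Q * D k.+1 (X k.+1))) = K / M / 2 ^+ k.+2.
    by rewrite /D -/Q; field; rewrite expf_neq0 ?pnatr_eq0// !gt_eqF.
  apply: (@le_trans _ _ (1 * (2 ^+ k.+2)^-1)).
    by rewrite ler_pM2r ?invr_gt0 ?exprn_gt0// ler_pdivrMr// mul1r lerDl.
  have p1 : 0 < k.+1%:R * 2 :> R by rewrite mulr_gt0 ?ltr0n.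
  have p2 : 0 < 2 ^+ k.+2 :> R by rewrite exprn_gt0.
  rewrite mul1r -invfM lef_pV2 ?posrE//.
  rewrite [leRHS]exprS mulrC ler_pM2l// -natrX ler_nat; exact/ltnW/ltn_expl.
exists xi, X; move=> k.
have Xw_ge0 : 0 <= (X k.+1).1%:~R `^ w :> R by exact: powR_ge0.
have combine (v : V) : 0 < v.1 <= (X k.+1).1 ->
    `|(X k.+1).1%:~R `^ w * N2 (residual xi v) -
      (X k.+1).1%:~R `^ w * N2 (residual (z k.+1) v)| <= k.+1%:R^-1 / 2.
  by move=> v_itv; rewrite -mulrBr normrM ger0_norm//; exact: perturb.
have [_ _ _ h1 h2] := stP k; rewrite -/(X k) -/(X k.+1) -/(z k.+1) in h1 h2.
have Dk := D_le k; have k_gt0 : 0 < k.+1%:R^-1 :> R by rewrite invr_gt0 ltr0n.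
split => //.
- have := combine (X k); rewrite X_gt0 X_mono => /(_ isT).
  move: h1; rewrite !ler_norml => /andP[_ h1] /andP[_].
  by move: h1 Dk k_gt0; move: (D k (X k)) (k.+1%:R^-1) => a a'; lra.
- move=> v /andP[v0 vX]; have := combine v; rewrite v0 ltW// => /(_ isT).
  have := h2 v; rewrite v0 vX => /(_ isT).
  rewrite ler_norml => h3 /andP[+ _].
  by move: h3 Dk k_gt0; move: (D k (X k)) (k.+1%:R^-1) => a a'; lra.
Qed.
End TunedVector.

(** * The Dirichlet constant *)

Section LimSup.
Variable R : realType.
Implicit Types (f : R -> \bar R) (c : R).

Lemma limf_esup_pinfty_le f c :
  (forall e, 0 < e -> exists M, forall t, M < t -> (f t <= (c + e)%:E)%E) ->
  (limf_esup f (pinfty_nbhs R) <= c%:E)%E.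
Proof.
move=> h; apply/lee_addgt0Pr => e e0; have [M hM] := h e e0.
rewrite -EFinD; apply: (@le_trans _ _ (ereal_sup (f @` [set t | M < t]))).
  apply: ereal_inf_lbound; exists [set t | M < t] => //.
  by exists M; split; rewrite ?num_real.
by apply: ge_ereal_sup => _ [t Mt <-]; exact: hM.
Qed.

Lemma limf_esup_pinfty_ge f c :
  (forall e, 0 < e -> forall M, exists2 t, M < t & ((c - e)%:E <= f t)%E) ->
  (c%:E <= limf_esup f (pinfty_nbhs R))%E.
Proof.
move=> h; apply: le_ereal_inf_tmp => _ [V [M [_ MV]] <-].
apply/lee_subgt0Pr => e e0; have [t Mt ft] := h e e0 M.
rewrite -EFinB; apply: le_trans ft _; apply: ereal_sup_ubound.
by exists t => //; exact: MV.
Qed.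

Lemma limf_einf_pinfty_le f c :
  (forall e, 0 < e -> forall M, exists2 t, M < t & (f t <= (c + e)%:E)%E) ->
  (limf_einf f (pinfty_nbhs R) <= c%:E)%E.
Proof.
move=> h; rewrite /limf_einf leeNl; apply: (@limf_esup_pinfty_ge _ (- c)).
move=> e e0 M; have [t Mt ft] := h e e0 M; exists t => //.
by rewrite leeNr -EFinN opprB opprK addrC.
Qed.
End LimSup.

Section Psi.
Variables (R : realType) (m n : nat).
Variables (N1 : 'cV[R]_n -> R) (N2 : 'cV[R]_m -> R).

Lemma psi_le (Om : 'M[R]_(m, n)) t b1 b2 : 1 <= N1 (int_cV R b1) <= t ->
  (psi N1 N2 Om t <= (N2 (Om *m int_cV R b1 + int_cV R b2))%:E)%E.
Proof. by move=> h; apply: ereal_inf_lbound; exists (b1, b2). Qed.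

Lemma psi_ge (Om : 'M[R]_(m, n)) t r :
  (forall b1 b2, 1 <= N1 (int_cV R b1) <= t ->
     r <= N2 (Om *m int_cV R b1 + int_cV R b2)) ->
  (r%:E <= psi N1 N2 Om t)%E.
Proof.
by move=> h; apply: le_ereal_inf_tmp => _ [[b1 b2] /= ht <-]; rewrite lee_fin h.
Qed.

(** For fixed [b1], the integer vector [B *m b1] is absorbed by a translation of [b2]. *)
Lemma psi_add_int (Om : 'M[R]_(m, n)) (B : 'M[int]_(m, n)) :
  psi N1 N2 (Om + map_mx intr B) = psi N1 N2 Om.
Proof.
apply/funext => t; congr ereal_inf; apply/seteqP.
have E b1 b2 : (Om + map_mx intr B) *m int_cV R b1 + int_cV R b2 =
    Om *m int_cV R b1 + int_cV R (B *m b1 + b2).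
  by rewrite mulmxDl -addrA /int_cV map_mxD map_mxM.
split => _ [[b1 b2] /= ht <-].
  by exists (b1, B *m b1 + b2) => //=; rewrite E.
by exists (b1, b2 - B *m b1) => //=; rewrite E [B *m b1 + _]addrC subrK.
Qed.
End Psi.

(** * Monotonicity of the dimension, and full rank *)

Section HausdorffMonotone.
Variables (R : realType) (V : normedModType R).

Lemma hausdorff_dim_ge0 (E : set V) : (0 <= hausdorff_dim E)%E.
Proof. by apply: le_ereal_inf_tmp => _ [s [s0 _] <-]; rewrite lee_fin. Qed.

Lemma le_hausdorff_dim (E F : set V) : E `<=` F ->
  (hausdorff_dim E <= hausdorff_dim F)%E.
Proof.
move=> EF; apply: le_ereal_inf => _ [s [s0 Fs] <-]; exists s => //; split => //.
apply/eqP; rewrite eq_le; apply/andP; split; last first.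
  apply: ereal_sup_ge; exists (hausdorff_content s 1 E); first by exists 1 => /=.
  apply: le_ereal_inf_tmp => _ [W _ <-].
  by apply: nneseries_ge0 => i _ _; exact: poweR_ge0.
apply: ge_ereal_sup => _ [d d0 <-]; rewrite -Fs.
apply: (@le_trans _ _ (hausdorff_content s d F)); last first.
  by apply: ereal_sup_ubound; exists d.
apply: le_ereal_inf => _ [W [FW Wd] <-]; exists W => //; split => //.
exact: subset_trans FW.
Qed.
End HausdorffMonotone.

(** Diagonal dominance: at a coordinate where a kernel vector attains its maximum norm, the term K
    |x_i| cannot be cancelled by the rest, which is at most n C |x_i|. *)
Lemma full_rank_shift (R : realType) (m n : nat) (M : 'M[R]_(m, n)) (C : R) (K : nat) :
  (n <= m)%N -> (forall i j, `|M i j| <= C) -> n%:R * C < K%:R ->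
  \rank (M + map_mx intr (\matrix_(i, j) (if i == j :> nat then K%:Z else 0)))%R = n.
Proof.
move=> nm MC nCK; set Om := M + _.
have ker0 (x : 'cV[R]_n) : Om *m x = 0 -> x = 0.
  move=> Ox; apply/eqP; rewrite -normr_eq0; apply/negPn/negP => x0.
  have [[i j] /= xi] := mx_norm_neq0 x0; rewrite (ord1 j) in xi.
  have im : (i < m)%N by apply: leq_trans nm.
  have := congr1 (fun A : 'cV[R]_m => A (Ordinal im) ord0) Ox.
  rewrite !mxE (eq_bigr (fun l => M (Ordinal im) l * x l ord0 +
    (i == l)%:R * (K%:R * x l ord0))); last first.
    move=> l _; rewrite !mxE mulrDl -[i == l]val_eqE /=; congr (_ + _).
    by case: eqP => _; rewrite ?mul1r ?mul0r// mulr0z mul0r.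
  rewrite big_split /=.
  have -> : \sum_(l < n) (i == l)%:R * (K%:R * x l ord0) = K%:R * x i ord0.
    rewrite (bigD1 i)//= eqxx mul1r big1 ?addr0// => l li.
    by rewrite eq_sym (negbTE li) mul0r.
  move=> /eqP; rewrite addrC addr_eq0 => /eqP Kx.
  have : K%:R * `|x i ord0| <= n%:R * C * `|x i ord0|.
    rewrite -[K%:R]normr_nat -normrM Kx normrN; apply: le_trans (ler_norm_sum _ _ _) _.
    apply: (@le_trans _ _ (\sum_(l < n) C * `|x i ord0|)); last first.
      by rewrite sumr_const card_ord -mulrA mulr_natl.
    apply: ler_sum => l _; rewrite normrM; apply: ler_pM => //.
    by rewrite -xi; exact: normM_coord_le.
  apply/negP; rewrite -ltNge ltr_pM2r//.
  by rewrite lt_neqAle normr_ge0 andbT eq_sym -xi.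
apply/eqP; rewrite eqn_leq rank_leq_col /= -mxrank_tr.
have : row_free Om^T.
  rewrite -kermx_eq0; apply/eqP/row_matrixP => i; rewrite row0.
  have := sub_kermxP (row_sub i (kermx Om^T)).
  move=> /(congr1 trmx); rewrite trmx_mul trmxK trmx0 => /ker0 /(congr1 trmx).
  by rewrite trmxK trmx0.
by rewrite /row_free => /eqP ->.
Qed.

Lemma first_axis_norm_gt0 (R : realType) (q : nat) (N : 'cV[R]_(1 + q) -> R) :
  is_norm N -> 0 < N (col_mx 1 0).
Proof.
move=> N_norm; apply: is_norm_gt0 => //.
apply/eqP => /matrixP /(_ (lshift q ord0) ord0).
by rewrite col_mxEu !mxE eqxx => /eqP; rewrite oner_eq0.
Qed.

(** * Matrices with a tuned first column *)

Section ThetaOfTunedColumn.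
Variables (R : realType) (m q : nat).
Local Notation V := (int * 'cV[int]_m)%type.
Variables (N1 : 'cV[R]_(1 + q) -> R) (N2 : 'cV[R]_m -> R).
Hypothesis N1_norm : is_norm N1.
Hypothesis N2_norm : is_norm N2.
Let w : R := (1 + q)%:R / m%:R.
Hypothesis w01 : 0 < w < 1.
Let nu := N1 (col_mx 1 0).
Variables (c : R) (xi : 'cV[R]_m) (X : nat -> V) (A : 'M[R]_(m, q)).
Hypothesis c_gt0 : 0 < c.
Hypothesis XP : forall k,
  [/\ 0 < (X k).1, (k.+1%:Z * (X k).1 <= (X k.+1).1),
    (X k.+1).1%:~R `^ w * N2 (residual xi (X k)) <= c / nu `^ w + k.+1%:R^-1 &
    forall v : V, 0 < v.1 < (X k.+1).1 ->
      c / nu `^ w - k.+1%:R^-1 <= (X k.+1).1%:~R `^ w * N2 (residual xi v)].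
Local Notation Om := (row_mx xi A).

Let nu_gt0 : 0 < nu. Proof. exact: first_axis_norm_gt0. Qed.

Let nuw_gt0 : 0 < nu `^ w. Proof. exact: powR_gt0. Qed.

Let w_ge0 : 0 <= w. Proof. by case/andP: w01 => /ltW. Qed.

Let X_gt0 k : 0 < (X k).1. Proof. by case: (XP k). Qed.

Let XR_gt0 k : 0 < (X k).1%:~R :> R. Proof. by rewrite ltr0z. Qed.

Let X_ge k : k.+1%:R <= (X k.+1).1%:~R :> R.
Proof.
have [X0 h _ _] := XP k; rewrite pmulrn ler_int; apply: le_trans h.
by rewrite ler_peMr// -gtz0_ge1.
Qed.

Let b1_of (a : int) : 'cV[int]_(1 + q) := col_mx a%:M 0.

Let N1_b1 a : N1 (int_cV R (b1_of a)) = `|a%:~R| * nu.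
Proof.
rewrite -is_normZ//; congr N1; rewrite /int_cV map_col_mx scale_col_mx; congr col_mx.
  by rewrite map_scalar_mx scalemx1.
by rewrite map_mx0 scaler0.
Qed.

Let Om_b1 a : Om *m int_cV R (b1_of a) = a%:~R *: xi.
Proof.
by rewrite /int_cV map_col_mx mul_row_col map_mx0 mulmx0 addr0 map_scalar_mx mul_mx_scalar.
Qed.

Let psi_X k t : 1 <= nu * (X k).1%:~R <= t ->
  (psi N1 N2 Om t <= (N2 (residual xi (X k)))%:E)%E.
Proof.
move=> ht; have := @psi_le _ _ _ N1 N2 Om t (b1_of (X k).1) (- (X k).2).
rewrite N1_b1 gtr0_norm// mulrC => /(_ ht) /le_trans; apply.
by rewrite lee_fin Om_b1 /int_cV map_mxN -is_normN// opprB.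
Qed.

Let harmonic_small (a e : R) : 0 < e ->
  exists K : nat, forall k, (K <= k)%N -> a * k.+1%:R^-1 <= e.
Proof.
move=> e0; exists (Num.truncn `|a / e|) => k Kk.
rewrite ler_pdivrMr ?ltr0n// mulrC -ler_pdivrMr//.
apply: le_trans (ler_norm _) _.
have /andP[_ /ltW h] := truncn_itv (normr_ge0 (a / e)).
by apply: le_trans h _; rewrite ler_nat.
Qed.

(** For [t] between [nu * (X k).1] and [nu * (X k.+1).1], test with the multiple [(X k).1] of the
    first basis vector. The factor t^w is largest at the right end, where the tuning gives c plus an
    error of order 1/(k+1). *)
Lemma Theta_tuned_le : (Theta N1 N2 Om <= c%:E)%E.
Proof.
apply: limf_esup_pinfty_le => e e0.
(* [K1] makes the error at most [e]; [K2] makes [nu * (X k).1] at least 1, so that the test vector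
   is admissible. *)
have [K1 hK1] := harmonic_small (nu `^ w) e0.
have [K2 hK2] := harmonic_small 1 nu_gt0.
pose K := maxn K1 K2.+1.
exists (nu * (X K).1%:~R) => t Kt.
have t0 : 0 < t by apply: lt_trans Kt; rewrite mulr_gt0.
have exj : exists j, t < nu * (X j).1%:~R.
  exists (Num.truncn (t / nu)).+1; rewrite mulrC -ltr_pdivrMr//.
  have /andP[_ h] := truncn_itv (ltW (divr_gt0 t0 nu_gt0)).
  exact: lt_le_trans h (X_ge _).
have [j tj jmin] := ex_minnP exj.
have X_mono i l : (i <= l)%N -> (X i).1 <= (X l).1.
  apply: (@homo_leq _ (fun k => (X k).1) (fun x y => x <= y)) => // [y x z|i'].
    exact: le_trans.
  by have [_ h _ _] := XP i'; apply: le_trans h; rewrite ler_peMl ?(ltW (X_gt0 _)).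
have Kj : (K < j)%N.
  rewrite ltnNge; apply/negP => jK; move: tj; apply/negP; rewrite -leNgt.
  by apply: le_trans (ltW Kt); rewrite ler_pM2l// ler_int X_mono.
case: j Kj tj jmin => // k Kk tk kmin.
have kt : nu * (X k).1%:~R <= t.
  by rewrite leNgt; apply/negP => /kmin; rewrite ltnn.
rewrite ltnS in Kk.
have K2k : (K2 < k)%N by exact: leq_trans (leq_maxr _ _) Kk.
have one_le : 1 <= nu * (X k).1%:~R.
  case: k K2k {Kk tk kmin kt} => // k K2k.
  have := hK2 k K2k; rewrite mul1r => h.
  apply: (@le_trans _ _ (k.+1%:R^-1 * k.+1%:R)); first by rewrite mulVf ?pnatr_eq0.
  by apply: ler_pM; rewrite ?invr_ge0 ?ler0n.
have ht : 1 <= nu * (X k).1%:~R <= t by rewrite one_le.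
apply: (@le_trans _ _ ((t `^ w)%:E * (N2 (residual xi (X k)))%:E)%E).
  by apply: lee_wpmul2l (psi_X ht); rewrite lee_fin powR_ge0.
rewrite -EFinM lee_fin; have [_ _ h _] := XP k.
apply: (@le_trans _ _ (nu `^ w * (c / nu `^ w + k.+1%:R^-1))).
  apply: (@le_trans _ _ ((nu * (X k.+1).1%:~R) `^ w * N2 (residual xi (X k)))).
    apply: ler_wpM2r; first exact: is_norm_ge0.
    by apply: ge0_ler_powR => //; rewrite ?nnegrE ?mulr_ge0 ?(ltW t0) ?(ltW nu_gt0)
      ?(ltW (XR_gt0 _)) ?(ltW tk).
  by rewrite powRM ?(ltW nu_gt0) ?(ltW (XR_gt0 _))// -mulrA ler_pM2l.
rewrite mulrDr mulrC divfK ?gt_eqF// lerD2l; apply: hK1.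
exact: leq_trans (leq_maxl _ _) Kk.
Qed.

(** The same test vector is used at the left end [t = nu * (X k).1], which gains the factor ((X k).1
    / (X k.+1).1)^w <= (k+1)^(-w). *)
Lemma Theta_low_tuned_le : (Theta_low N1 N2 Om <= 0)%E.
Proof.
apply: limf_einf_pinfty_le => e e0 M; rewrite add0r.
pose C := nu `^ w * (c / nu `^ w + 1).
have C0 : 0 < C by rewrite mulr_gt0// addr_gt0// divr_gt0.
have eC : 0 < (e / C) `^ w^-1 by rewrite powR_gt0// divr_gt0.
have [K1 hK1] := harmonic_small 1 eC.
have [K2 hK2] := harmonic_small (`|M| + 1) nu_gt0.
pose k := (maxn K1 K2.+1).
have XE : `|M| + 1 <= nu * (X k).1%:~R.
  have : (K2 < k)%N by exact: leq_maxr.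
  case: k => // l K2l; have := hK2 l K2l; rewrite ler_pdivrMr ?ltr0n// => h.
  by apply: le_trans h _; rewrite ler_pM2l.
have t0 : 0 < nu * (X k).1%:~R by rewrite mulr_gt0.
exists (nu * (X k).1%:~R).
  by apply: lt_le_trans XE; have := ler_norm M; lra.
have ht : 1 <= nu * (X k).1%:~R <= nu * (X k).1%:~R.
  by rewrite lexx andbT; apply: le_trans XE; rewrite lerDr.
apply: (@le_trans _ _ (((nu * (X k).1%:~R) `^ w)%:E * (N2 (residual xi (X k)))%:E)%E).
  by apply: lee_wpmul2l (psi_X ht); rewrite lee_fin powR_ge0.
rewrite -EFinM lee_fin; have [_ gr h _] := XP k.
have rat : ((X k).1%:~R / (X k.+1).1%:~R) `^ w <= e / C.
  have w0 : w != 0 by rewrite gt_eqF//; case/andP: w01.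
  have -> : e / C = ((e / C) `^ w^-1) `^ w.
    by rewrite -powRrM mulVf// powRr1// ltW// divr_gt0.
  apply: ge0_ler_powR => //; rewrite ?nnegrE ?divr_ge0 ?(ltW (XR_gt0 _)) ?(ltW eC)//.
  rewrite ler_pdivrMr//; have := hK1 k (leq_maxl _ _); rewrite mul1r => h1.
  apply: (@le_trans _ _ (k.+1%:R^-1 * (X k.+1).1%:~R)); last by rewrite ler_pM2r.
  by rewrite ler_pdivlMl ?ltr0n// -(ler_int R) intrM -pmulrn in gr *.
have -> : (nu * (X k).1%:~R) `^ w =
    nu `^ w * (((X k).1%:~R / (X k.+1).1%:~R) `^ w * (X k.+1).1%:~R `^ w).
  by rewrite -powRM ?divr_ge0 ?(ltW (XR_gt0 _))// divfK ?gt_eqF// -powRM ?(ltW (XR_gt0 _)) ?(ltW nu_gt0).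
apply: (@le_trans _ _ (nu `^ w * (e / C * (c / nu `^ w + 1)))).
  rewrite -[leLHS]mulrA ler_pM2l// -[leLHS]mulrA; apply: ler_pM => //.
  - exact: powR_ge0.
  - by rewrite mulr_ge0 ?powR_ge0 ?is_norm_ge0.
  by apply: le_trans h _; rewrite lerD2l invf_le1 ?ltr0n// ler1n.
by rewrite mulrCA -/C divfK// gt_eqF.
Qed.

Hypothesis far : forall K, exists2 k, (K <= k)%N & forall b1 b2,
  dsubmx b1 != 0 -> N1 (int_cV R b1) <= nu * (X k.+1).1%:~R ->
  c / (nu * (X k.+1).1%:~R) `^ w <= N2 (Om *m int_cV R b1 + int_cV R b2).

(** Just below [nu * (X k.+1).1], integer vectors that involve a column of [A] are controlled by
    [far], and multiples of the first basis vector by the lower bound in [XP]. *)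
Lemma Theta_tuned_ge : (c%:E <= Theta N1 N2 Om)%E.
Proof.
apply: limf_esup_pinfty_ge => e e0 M.
have [K1 hK1] := harmonic_small (c + nu `^ w) e0.
have [K2 hK2] := harmonic_small (`|M| + nu) nu_gt0.
have [K3 hK3] := harmonic_small (nu `^ w) c_gt0.
have [k Kk far_k] := far (maxn (maxn K1 K3) K2).
have K1k : (K1 <= k)%N by apply: leq_trans Kk; rewrite !leq_max leqnn.
have K2k : (K2 <= k)%N by apply: leq_trans Kk; rewrite !leq_max leqnn orbT.
have K3k : (K3 <= k)%N by apply: leq_trans Kk; rewrite !leq_max leqnn orbT.
pose Q : R := (X k.+1).1%:~R; have Q0 : 0 < Q by exact: XR_gt0.
have kQ : k.+1%:R <= Q by exact: X_ge.
have Q1 : 1 <= Q by apply: le_trans kQ; rewrite ler1n.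
pose h : R := k.+1%:R^-1; have h0 : 0 < h by rewrite invr_gt0 ltr0n.
have MQ : `|M| + nu <= nu * Q.
  have := hK2 k K2k; rewrite ler_pdivrMr ?ltr0n// => /le_trans; apply.
  by rewrite ler_pM2l.
(* Subtracting 1/2 keeps first coordinates strictly below [(X k.+1).1] and costs only the factor 1 -
   1/(2Q) >= 1 - h. *)
pose t := nu * (Q - 2^-1).
have Mt : M < t.
  rewrite /t mulrBr; have := ler_norm M; have := nu_gt0.
  by move: MQ; move: (nu * Q) nu => ? ?; lra.
have t0 : 0 < t by rewrite mulr_gt0//; lra.
exists t => //.
have nuQ : 0 < nu * Q by rewrite mulr_gt0.
have D0 : 0 < (nu * Q) `^ w by rewrite powR_gt0.
have num_ge0 : 0 <= c - nu `^ w * h by rewrite subr_ge0; exact: hK3.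
have psi_t : (((c - nu `^ w * h) / (nu * Q) `^ w)%:E <= psi N1 N2 Om t)%E.
  apply: psi_ge => b1 b2 /andP[b1_ge b1_le].
  have [b1d|b1d] := eqVneq (dsubmx b1) 0; last first.
    apply: le_trans (far_k b1 b2 b1d _).
      by rewrite ler_pM2r ?invr_gt0// gerBl mulr_ge0// ltW.
    by apply: le_trans b1_le _; rewrite ler_pM2l// gerBl invr_ge0.
  pose a := usubmx b1 ord0 ord0.
  have b1E : b1 = b1_of a.
    rewrite -(vsubmxK b1) b1d /b1_of; congr col_mx.
    by apply/matrixP => i j; rewrite !ord1 [RHS]mxE eqxx mulr1n.
  rewrite b1E N1_b1 in b1_ge b1_le.
  have a0 : a != 0.
    by apply: contraTneq b1_ge => ->; rewrite normr0 mul0r -ltNge.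
  have aQ : `|a| < (X k.+1).1.
    rewrite -(ltr_int R) intr_norm; move: b1_le; rewrite mulrC ler_pM2l// => /le_lt_trans.
    by apply; rewrite ltrBlDr ltrDl.
  (* The sign is chosen to make the denominator of [v] positive, as [XP] requires. *)
  have [v [v1 vE]] : exists v : V, v.1 = `|a| /\
      N2 (Om *m int_cV R b1 + int_cV R b2) = N2 (residual xi v).
    rewrite b1E Om_b1; have [a_ge|a_lt] := leP 0 a.
      exists (a, - b2); split; first by rewrite ger0_norm.
      by rewrite /residual /int_cV /= map_mxN -is_normN// opprD addrC.
    exists (- a, b2); split; first by rewrite ltr0_norm.
    by rewrite /residual /= mulrNz scaleNr opprK addrC.
  have [_ _ _ /(_ v)] := XP k.
  rewrite v1 normr_gt0 a0 aQ => /(_ isT) low; rewrite vE ler_pdivrMr//.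
  rewrite powRM ?(ltW nu_gt0) ?(ltW Q0)// mulrCA -/Q -/h in low *.
  rewrite -ler_pdivrMl// mulrC [leRHS]mulrC; apply: le_trans low.
  by rewrite mulrBl mulrAC divff ?gt_eqF// mul1r.
apply: (@le_trans _ _ ((t `^ w)%:E * ((c - nu `^ w * h) / (nu * Q) `^ w)%:E)%E); last first.
  by apply: lee_wpmul2l psi_t; rewrite lee_fin powR_ge0.
rewrite -EFinM lee_fin.
have tQ : 1 - h <= t `^ w / (nu * Q) `^ w.
  have t_ratio : t = (1 - (2 * Q)^-1) * (nu * Q) by rewrite /t; field; rewrite gt_eqF.
  have r0 : 0 < 1 - (2 * Q)^-1 by rewrite subr_gt0 invf_lt1; lra.
  rewrite t_ratio (powRM _ (ltW r0) (ltW nuQ)) mulfK ?gt_eqF//.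
  apply: (@le_trans _ _ (1 - (2 * Q)^-1)).
    rewrite lerD2l lerN2 lef_pV2 ?posrE ?ltr0n//; lra.
  apply: ger1_powR; last by apply: ltW; case/andP: w01.
  by rewrite r0 /= gerBl invr_ge0; lra.
rewrite mulrA mulrAC.
apply: (@le_trans _ _ ((1 - h) * (c - nu `^ w * h))); last by rewrite ler_wpM2r.
have := hK1 k K1k; rewrite -/h.
have := mulr_ge0 (ltW nuw_gt0) (sqr_ge0 h).
rewrite expr2; nra.
Qed.

End ThetaOfTunedColumn.

(** * Construction of the sets of matrices *)

Section MainConstruction.
Variables (R : realType) (m' q : nat).
Local Notation m := m'.+1.
Local Notation V := (int * 'cV[int]_m)%type.
Variables (N1 : 'cV[R]_(1 + q) -> R) (N2 : 'cV[R]_m -> R).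
Hypothesis N1_norm : is_norm N1.
Hypothesis N2_norm : is_norm N2.
Hypothesis qm : (1 + q < m)%N.
Local Notation w := ((1 + q)%:R / m%:R : R).
Local Notation nu := (N1 (col_mx 1 0)).

Lemma exponent_itv : 0 < w < 1.
Proof.
by rewrite divr_gt0 ?ltr0n//= ltr_pdivrMr ?ltr0n// mul1r ltr_nat.
Qed.

(** The target is c / nu^w because a times the first basis vector has N1-norm |a| nu; [c0] solves
    the smallness condition of [exists_tuned_vector] for this target. *)
Lemma exists_tuned_column : exists2 c0, 0 < c0 & forall c, 0 < c <= c0 ->
  exists (xi : 'cV[R]_m) (X : nat -> V), forall k,
  [/\ 0 < (X k).1, (k.+1%:Z * (X k).1 <= (X k.+1).1),
    (X k.+1).1%:~R `^ w * N2 (residual xi (X k)) <= c / nu `^ w + k.+1%:R^-1 &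
    forall v : V, 0 < v.1 < (X k.+1).1 ->
      c / nu `^ w - k.+1%:R^-1 <= (X k.+1).1%:~R `^ w * N2 (residual xi v)].
Proof.
have [K K0 N2K] := is_norm_upper N2_norm.
have [kappa k0 N2k] := is_norm_lower N2_norm.
have nuw : 0 < nu `^ w by rewrite powR_gt0// first_axis_norm_gt0.
pose L := (8 * K / kappa) `^ (1 - w).
have L0 : 0 < L by rewrite powR_gt0// divr_gt0// mulr_gt0.
exists (kappa / 4 / L * nu `^ w); first by rewrite !mulr_gt0// ?invr_gt0// divr_gt0.
move=> c /andP[c0 cle]; apply: (exists_tuned_vector (kappa := kappa) (K := K)) => //.
- exact: exponent_itv.
- by rewrite divfK ?pnatr_eq0// ler1n.
- by rewrite divr_gt0.
- by rewrite -/L -ler_pdivlMr// ler_pdivrMr.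
Qed.

Lemma rescaled_psi_zero_column (A : 'M[R]_(m, q)) : exists M, forall t, M < t ->
  (rescaled_psi N1 N2 (row_mx 0 A) t <= 0)%E.
Proof.
have nu0 := first_axis_norm_gt0 N1_norm.
pose a := (Num.truncn nu^-1).+1.
have a1 : 1 <= a%:R * nu.
  rewrite -ler_pdivrMr// div1r.
  have nuV : 0 <= nu^-1 by rewrite invr_ge0 ltW.
  by have /andP[_ /ltW] := truncn_itv nuV.
exists (a%:R * nu) => t at_.
pose b1 : 'cV[int]_(1 + q) := col_mx a%:Z%:M 0.
have b1E : int_cV R b1 = a%:R *: col_mx 1 0.
  by rewrite /int_cV map_col_mx map_mx0 map_scalar_mx scale_col_mx scaler0 -scalemx1.
have ht : 1 <= N1 (int_cV R b1) <= t.
  by rewrite b1E is_normZ// normr_nat a1 ltW.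
have t0 : (0 <= (t `^ w)%:E)%E by rewrite lee_fin powR_ge0.
apply: le_trans (lee_wpmul2l t0 (psi_le N2 (row_mx 0 A) 0 ht)) _.
rewrite b1E -scalemxAr mul_row_col mul0mx mulmx0 addr0 scaler0 add0r /int_cV map_mx0.
by rewrite is_norm0// mule0.
Qed.

(** This settles c = 0, which the tuning excludes: a zero first column maps a multiple of the first
    basis vector to 0, so [psi] vanishes for large [t]. *)
Lemma Theta_zero_column (A : 'M[R]_(m, q)) :
  Theta N1 N2 (row_mx 0 A) = 0%E /\ (Theta_low N1 N2 (row_mx 0 A) <= 0)%E.
Proof.
have [M hM] := rescaled_psi_zero_column A.
split; last first.
  apply: limf_einf_pinfty_le => e e0 M'; exists (Num.max M M' + 1).
    by rewrite ltr_pwDr// le_max lexx orbT.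
  apply: le_trans (hM _ _) _; last by rewrite add0r lee_fin ltW.
  by rewrite ltr_pwDr// le_max lexx.
apply/eqP; rewrite eq_le; apply/andP; split.
  apply: limf_esup_pinfty_le => e e0; exists M => t /hM /le_trans; apply.
  by rewrite add0r lee_fin ltW.
apply: limf_esup_ge0.
  by move=> [M' [_ /(_ (M' + 1))]]; apply; rewrite ltrDl.
move=> t; rewrite mule_ge0 ?lee_fin ?powR_ge0//.
by apply: psi_ge => *; exact: is_norm_ge0.
Qed.

Lemma FS_shift (Om : 'M[R]_(m, 1 + q)) (B : 'M[int]_(m, 1 + q)) c :
  Theta N1 N2 Om = c%:E -> (Theta_low N1 N2 Om <= 0)%E ->
  FS N1 N2 c (Om + map_mx intr B).
Proof.
move=> Th Tl; split; first by rewrite /DI /= /Theta /rescaled_psi psi_add_int.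
by rewrite /Bad /= /Theta_low /rescaled_psi psi_add_int; apply/negP; rewrite -leNgt.
Qed.

End MainConstruction.

Section PositiveDimension.
Variables (R : realType) (m' p : nat).
Local Notation m := m'.+1.
Local Notation d := (m * p.+1)%N.
Variables (N1 : 'cV[R]_(1 + p.+1) -> R) (N2 : 'cV[R]_m -> R).
Hypothesis N1_norm : is_norm N1.
Hypothesis N2_norm : is_norm N2.
Hypothesis qm : (1 + p.+1 < m)%N.
Local Notation w := ((1 + p.+1)%:R / m%:R : R).
Local Notation nu := (N1 (col_mx 1 0)).
Variable mu : probability (d.-tuple R) R.
Hypothesis mu_tri : triangular_bound mu.

Lemma exists_tuned_columns : exists2 c0, 0 < c0 & forall c, 0 <= c <= c0 ->
  exists (xi : 'cV[R]_m) (G : set (d.-tuple R)), [/\ measurable G, (0 < mu G)%E &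
    forall s, G s -> Theta N1 N2 (extended_matrix xi s) = c%:E /\
      (Theta_low N1 N2 (extended_matrix xi s) <= 0)%E].
Proof.
have nu0 := first_axis_norm_gt0 N1_norm.
have [c0 c0_gt0 tuned] := exists_tuned_column N1_norm N2_norm qm.
have [kappa1 k1_gt0 N1k] := is_norm_lower N1_norm.
have [kappa k_gt0 N2k] := is_norm_lower N2_norm.
pose C := kappa1^-1; have C0 : 0 < C by rewrite invr_gt0.
have N1C x : `|x| <= C * N1 x by rewrite ler_pdivlMl.
(* With c <= kappa/(6B) the failure probability at each scale, (2C+3)^n (6c/kappa)^m with n = p + 2,
   is at most 1/2; the powers of [t] cancel since w m = n. *)
pose B := 2 * (2 * C + 3) ^+ (1 + p.+1).
have B2 : 2 <= B by rewrite ler_peMr// exprn_ege1//; lra.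
pose c1 := kappa / (6 * B).
have c1_gt0 : 0 < c1 by rewrite divr_gt0//; lra.
exists (Num.min c0 c1); first by rewrite lt_min c0_gt0.
move=> c /andP[c_ge0]; rewrite le_min => /andP[cc0 cc1].
have [->|c_neq0] := eqVneq c 0.
  exists 0, setT; split => //; first by rewrite probability_setT.
  by move=> s _; exact: Theta_zero_column.
have c_gt0 : 0 < c by rewrite lt_neqAle eq_sym c_neq0.
have c_itv : 0 < c <= c0 by rewrite c_gt0.
have [xi [X XP]] := tuned c c_itv.
(* Skipping the first [k0] denominators ensures that every scale [t k] is at least 1. *)
pose k0 := Num.truncn nu^-1.
pose t k : R := nu * (X (k0 + k).+1).1%:~R.
have t_ge1 k : 1 <= t k.
  have nuV : 0 <= nu^-1 by rewrite invr_ge0 ltW.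
  rewrite -ler_pdivrMl// mulr1.
  have /andP[_ /ltW /le_trans] := truncn_itv nuV; apply.
  have [X0 h _ _] := XP (k0 + k)%N.
  rewrite pmulrn ler_int; apply: le_trans h; apply: (@le_trans _ _ (k0 + k).+1%:Z).
    by rewrite lez_nat ltnS leq_addr.
  by rewrite ler_peMr// -gtz0_ge1.
have t_gt0 k : 0 < t k := lt_le_trans ltr01 (t_ge1 k).
pose delta k := c / t k `^ w.
have delta_ge0 k : 0 <= delta k by rewrite divr_ge0 ?powR_ge0// ltW.
have /choice[G GP] k := exists_far_from_int xi mu_tri C0 k_gt0 (t_ge1 k) (delta_ge0 k) N1C N2k.
have mG k : measurable (G k) by case: (GP k).
have muG k : ((2^-1)%:E <= mu (G k))%E.
  have [_ h _] := GP k; rewrite -[G k]setCK probability_setC; last exact: measurableC.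
  have : (mu (~` G k) <= (2^-1)%:E)%E.
    apply: le_trans h _; rewrite lee_fin.
    have -> : ((2 * C + 3) * t k) ^+ (1 + p.+1) * (6 * (delta k / kappa)) ^+ m =
        (2 * C + 3) ^+ (1 + p.+1) * (6 * c / kappa) ^+ m.
      have tw : (t k `^ w) ^+ m = t k ^+ (1 + p.+1).
        by rewrite -!powR_mulrn ?powR_ge0 ?(ltW (t_gt0 k))// -powRrM divfK ?pnatr_eq0.
      rewrite exprMn -[LHS]mulrA; congr (_ * _).
      have -> : 6 * (delta k / kappa) = 6 * c / kappa / t k `^ w.
        by rewrite /delta; ring.
      by rewrite [X in _ * X]exprMn exprVn tw mulrCA divff ?mulr1// expf_neq0// gt_eqF.
    have cB : 6 * c / kappa <= B^-1.
      rewrite ler_pdivrMr// ler_pdivlMl; last by lra.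
      move: cc1; rewrite /c1 ler_pdivlMr; last by lra.
      lra.
    have x_ge0 : 0 <= 6 * c / kappa by rewrite !mulr_ge0// ?invr_ge0// ltW.
    have x_le1 : 6 * c / kappa <= 1 by apply: le_trans cB _; rewrite invf_le1; lra.
    apply: (@le_trans _ _ ((2 * C + 3) ^+ (1 + p.+1) * B^-1)).
      rewrite ler_pM2l; last by rewrite exprn_gt0//; lra.
      apply: le_trans cB; rewrite exprS ler_piMr//.
      exact: exprn_ile1.
    rewrite /B invfM mulrCA divff ?mulr1// expf_neq0// gt_eqF//; lra.
  have : mu (~` G k) \is a fin_num by rewrite fin_num_measure//; exact: measurableC.
  case: (mu _) => // r _; rewrite lee_fin => r2; rewrite -EFinB lee_fin; lra.
pose E := lim_sup_set G.
have mE : measurable E.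
  by apply: bigcap_measurable => // k _; apply: bigcup_measurable.
have muE : ((2^-1)%:E <= mu E)%E by exact: probability_lim_sup_ge.
exists xi, E; split => //; first by apply: lt_le_trans muE; rewrite lte_fin invr_gt0.
move=> s Es.
have w01 := exponent_itv R qm.
split; last exact: (Theta_low_tuned_le N1_norm N2_norm w01 _ c_gt0 XP).
apply/eqP; rewrite eq_le; apply/andP; split.
  exact: (Theta_tuned_le N1_norm N2_norm w01 _ XP).
apply: (Theta_tuned_ge N1_norm N2_norm w01 c_gt0 XP) => K.
have [k /= Kk Gs] := Es K I.
exists (k0 + k)%N; first exact: leq_trans (leq_addl _ _).
by case: (GP k) => _ _ /(_ s Gs).
Qed.

End PositiveDimension.

Lemma hausdorff_dim_extended_ge (R : realType) (m' p : nat)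
    (mu : probability ((m'.+1 * p.+1).-tuple R) R) (xi : 'cV[R]_m'.+1)
    (B : 'M[R]_(m'.+1, 1 + p.+1)) G :
  triangular_bound mu -> measurable G -> (0 < mu G)%E ->
  ((m'.+1 * p.+1)%:R%:E <=
    hausdorff_dim ((fun s => (extended_matrix xi s + B)%R) @` G))%E.
Proof.
move=> mu_tri mG muG; apply: (hausdorff_dim_image_ge mu_tri) => // s s' i.
apply: le_trans (matrix_of_tuple_dist s s' i) _.
rewrite opprD addrACA subrr addr0 /extended_matrix opp_row_mx add_row_mx subrr.
apply: normM_le => // k l.
have := normM_coord_le (row_mx 0 (matrix_of_tuple s - matrix_of_tuple s') :
  'M[R]_(m'.+1, 1 + p.+1)) k (rshift 1 l).
by rewrite row_mxEr.
Qed.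

Lemma extended_matrix_bound (R : realType) (m p : nat) (xi : 'cV[R]_m)
    (s : (m * p.+1).-tuple R) i j :
  (forall l, 0 <= tnth s l <= 1) -> `|extended_matrix xi s i j| <= 1 + `|xi|.
Proof.
move=> s01; rewrite mxE; case: fintype.split => l.
  by apply: le_trans (normM_coord_le xi i l) _; rewrite lerDr.
rewrite mxE; apply: (@le_trans _ _ 1); last by rewrite lerDl.
have lt_pos : (i * p.+1 + l < m * p.+1)%N.
  apply: (@leq_trans (i.+1 * p.+1)); last by rewrite leq_mul2r ltn_ord orbT.
  by rewrite mulSn addnC ltn_add2r.
have := s01 (Ordinal lt_pos); rewrite (tnth_nth 0) /= => /andP[s0 s1].
by rewrite ger0_norm.
Qed.

(** For n = 1 there is no random column and the dimension bound is 0, so one matrix suffices. For n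
    >= 2 the set is the image of the good tuples in the unit cube, shifted by an integer multiple of
    the identity block. *)
Lemma exists_FS_subset (R : realType) (m n : nat) (N1 : 'cV[R]_n -> R) (N2 : 'cV[R]_m -> R) :
  (0 < n < m)%N -> is_norm N1 -> is_norm N2 ->
  exists2 c0, 0 < c0 & forall c, 0 <= c <= c0 -> exists E : set 'M[R]_(m, n),
    [/\ E !=set0, E `<=` FS N1 N2 c `&` full_rank &
      ((m * n.-1)%:R%:E <= hausdorff_dim E)%E].
Proof.
case: m N2 => [|m'] N2; first by rewrite ltn0 andbF.
case: n N1 => [|[|p]] N1 //= nm N1_norm N2_norm.
  have [c0 c0_gt0 tuned] := @exists_tuned_column R m' 0 N1 N2 N1_norm N2_norm nm.
  exists c0 => // c /andP[c_ge0 cc0].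
  have [xi [Th Tl]] : exists xi : 'cV[R]_(m'.+1),
      Theta N1 N2 (row_mx xi (0 : 'M[R]_(m'.+1, 0))) = c%:E /\
      (Theta_low N1 N2 (row_mx xi (0 : 'M[R]_(m'.+1, 0))) <= 0)%E.
    have [->|c_neq0] := eqVneq c 0.
      by exists 0; exact: (@Theta_zero_column _ _ 0).
    have c_gt0 : 0 < c by rewrite lt_neqAle eq_sym c_neq0.
    have c_itv : 0 < c <= c0 by rewrite c_gt0.
    have [xi [X XP]] := tuned c c_itv.
    have w01 := @exponent_itv R m' 0 nm.
    exists xi; split; last exact: (Theta_low_tuned_le N1_norm N2_norm w01 _ c_gt0 XP).
    apply/eqP; rewrite eq_le; apply/andP; split.
      exact: (Theta_tuned_le N1_norm N2_norm w01 _ XP).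
    apply: (Theta_tuned_ge N1_norm N2_norm w01 c_gt0 XP) => K.
    by exists K => // b1 b2; rewrite (flatmx0 (dsubmx b1)) eqxx.
  pose Om : 'M[R]_(m'.+1, 1) := row_mx xi (0 : 'M[R]_(m'.+1, 0)).
  pose K := (Num.truncn (1 * `|Om|)).+1.
  pose B : 'M[int]_(m'.+1, 1) := \matrix_(i, j) (if i == j :> nat then K%:Z else 0).
  exists [set Om + map_mx intr B]; split.
  - by exists (Om + map_mx intr B).
  - move=> _ ->; split; first exact: (@FS_shift _ _ 0).
    apply: (@full_rank_shift _ _ _ Om `|Om|) => // [i j|]; first exact: normM_coord_le.
    by have /andP[] := truncn_itv (mulr_ge0 ler01 (normr_ge0 Om)).
  - by rewrite muln0; exact: hausdorff_dim_ge0.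
have [mu mu_tri] := exists_triangular_bound R (m'.+1 * p.+1).
have [c0 c0_gt0 tuned] := @exists_tuned_columns R m' p N1 N2 N1_norm N2_norm nm mu mu_tri.
exists c0 => // c c_itv; have [xi [G [mG muG GP]]] := tuned c c_itv.
(* Restricting to the cube loses no mass and bounds all entries, so that a single shift [K] serves
   every matrix of the set. *)
pose cube := [set s : (m'.+1 * p.+1).-tuple R | forall i, 0 <= tnth s i <= 1].
have mcube : measurable cube by exact: measurable_cube.
have muGc : (0 < mu (G `&` cube))%E.
  have : (mu G <= mu (G `&` cube) + mu (~` cube))%E.
    apply: le_trans (measureU2 _ _ _); rewrite ?inE.
    - apply: le_measure; rewrite ?inE//.
        by apply: measurableU; [exact: measurableI|exact: measurableC].
      by move=> s Gs; have [sc|sc] := pselect (cube s); [left|right].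
    - exact: measurableI.
    - exact: measurableC.
  by rewrite (tuple_prob_cubeC mu_tri) adde0; exact: lt_le_trans.
pose K := (Num.truncn (p.+2%:R * (1 + `|xi|))).+1.
pose B : 'M[int]_(m'.+1, 1 + p.+1) := \matrix_(i, j) (if i == j :> nat then K%:Z else 0).
exists ((fun s => extended_matrix xi s + map_mx intr B) @` (G `&` cube)); split.
- have [s Gs] : (G `&` cube) !=set0.
    by apply/set0P; apply: contraTneq muGc => ->; rewrite measure0 ltxx.
  by eexists; exists s.
- move=> _ [s [Gs cs] <-]; have [Th Tl] := GP s Gs; split; first exact: FS_shift.
  apply: (@full_rank_shift _ _ _ (extended_matrix xi s) (1 + `|xi|)).
  - exact: ltnW.
  - by move=> i j; exact: extended_matrix_bound.
  - have C0 : 0 <= p.+2%:R * (1 + `|xi|) by rewrite mulr_ge0// addr_ge0.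
    by have /andP[] := truncn_itv C0.
- by apply: (hausdorff_dim_extended_ge xi (map_mx intr B) mu_tri) => //; exact: measurableI.
Qed.

Theorem theorem3p4 (R : realType) (m n : nat)
  (m_gt0 : (0 < m)%N) (n_gt0 : (0 < n)%N)
  (mn_gt1 : 1 < m%:R / n%:R :> R)
  (mn_excl : forall k : nat, (m, n) <> (2 * k + 3, 2)%N)
  (N1 : 'cV[R]_n -> R) (N2 : 'cV[R]_m -> R)
  (N1_norm : is_norm N1) (N2_norm : is_norm N2)
  (N2_expanding : expanding N2)
  (N1_expanding : n = 2%N -> expanding N1) :
  exists cmn : R, 0 < cmn /\
  [/\ forall c : R, 0 <= c <= cmn ->
        [/\ FS N1 N2 c !=set0,
            ~ (n = 2%N \/ (m, n) = (4, 3)%N) ->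
              ((m%:R * (n%:R - 1) - (Num.ceil (m%:R / n%:R : R))%:~R)%:E
                 <= hausdorff_dim (FS N1 N2 c))%E
          & (m, n) = (4, 3)%N -> (4%:R%:E <= hausdorff_dim (FS N1 N2 c))%E],
      exists2 e : R, 0 < e &
        forall c : R, 0 <= c < e -> Dirichlet_spectrum N1 N2 c%:E,
      forall c : R, 0 <= c <= cmn ->
        [/\ FS N1 N2 c `&` full_rank !=set0,
            ~ (n = 2%N \/ (m, n) = (4, 3)%N) ->
              ((m%:R * (n%:R - 1) - (Num.ceil (m%:R / n%:R : R))%:~R)%:E
                 <= hausdorff_dim (FS N1 N2 c `&` full_rank))%E
          & (m, n) = (4, 3)%N ->
              (4%:R%:E <= hausdorff_dim (FS N1 N2 c `&` full_rank))%E]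
    & exists2 e : R, 0 < e &
        forall c : R, 0 <= c < e -> (Theta N1 N2 @` full_rank) c%:E].
Proof.
have nR_gt0 : 0 < n%:R :> R by rewrite ltr0n.
have nm : (0 < n < m)%N.
  by rewrite n_gt0 -(ltr_nat R); move: mn_gt1; rewrite ltr_pdivlMr// mul1r.
have [c0 c0_gt0 subset_FS] := exists_FS_subset nm N1_norm N2_norm.
have ceil_ge0 : 0 <= (Num.ceil (m%:R / n%:R : R))%:~R :> R.
  by apply: le_trans (ceil_ge _); rewrite divr_ge0.
(* The dimension reached is m (n - 1), which exceeds the claimed bound by the nonnegative ceiling;
   for (4, 3) it equals 8. *)
have dim_ge (F : set 'M[R]_(m, n)) : ((m * n.-1)%:R%:E <= hausdorff_dim F)%E ->
    ((m%:R * (n%:R - 1) - (Num.ceil (m%:R / n%:R : R))%:~R)%:E <= hausdorff_dim F)%E.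
  apply: le_trans; rewrite lee_fin natrM -subn1 natrB//.
  by rewrite gerBl.
have dim_ge43 (F : set 'M[R]_(m, n)) : ((m * n.-1)%:R%:E <= hausdorff_dim F)%E ->
    (m, n) = (4, 3)%N -> (4%:R%:E <= hausdorff_dim F)%E.
  by move=> + [m4 n3]; apply: le_trans; rewrite lee_fin ler_nat m4 n3.
exists c0; split => //; split.
- move=> c /subset_FS[E [[Om EOm] EF dimE]].
  have {}dimE : ((m * n.-1)%:R%:E <= hausdorff_dim (FS N1 N2 c))%E.
    by apply: le_trans dimE (le_hausdorff_dim _) => A /EF[].
  split; first by exists Om; case: (EF _ EOm).
    by move=> _; exact: dim_ge.
  exact: dim_ge43.
- exists c0 => // c /andP[c_ge0 cc0].
  have [|E [[Om EOm] EF _]] := subset_FS c; first by rewrite c_ge0 ltW.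
  by have [[Th _] _] := EF _ EOm; exists Om.
- move=> c /subset_FS[E [[Om EOm] EF dimE]].
  have {}dimE : ((m * n.-1)%:R%:E <= hausdorff_dim (FS N1 N2 c `&` full_rank))%E.
    exact: le_trans dimE (le_hausdorff_dim EF).
  split; first by exists Om; exact: EF.
    by move=> _; exact: dim_ge.
  exact: dim_ge43.
- exists c0 => // c /andP[c_ge0 cc0].
  have [|E [[Om EOm] EF _]] := subset_FS c; first by rewrite c_ge0 ltW.
  by have [[Th _] rk] := EF _ EOm; exists Om.
Qed.
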